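(* Let $f$ be an irreducible rational inner function on $\mathbb{D}^n$ such that $f(0)=0$. Then there is a unimodular constant $c$ such that either $f(z)=c\,z_j$ for some $j\in\{1,\dots,n\}$, or $$f(z)=c\,\frac{z^{\nu(\mathcal{Q})}\,\widetilde{\mathcal{Q}}\left(\frac{1}{z}\right)}{\mathcal{Q}(z)},$$ where $\mathcal{Q}\in\mathbb{C}[z_1,\dots,z_n]$ is an irreducible polynomial having no zeros in $\mathbb{D}^n$ and is deficient in degree.
   Context: $\mathbb{D}$ is the open unit disc in $\mathbb{C}$, $\mathbb{T}=\partial\mathbb{D}$, and $\mathcal{O}(\mathbb{D}^n)$ is the ring of holomorphic functions on $\mathbb{D}^n$. An inner function on $\mathbb{D}^n$ is a bounded holomorphic function $f$ on $\mathbb{D}^n$ with $\lim_{r\to1^-}|f(rw)|=1$ for almost every $w\in\mathbb{T}^n$; a rational inner function is an inner function that is rational. A nonconstant rational inner function $f$ on $\mathbb{D}^n$ is called irreducible if it cannot be expressed as $f=gh$ with $g$ and $h$ rational inner functions that are both nonunits in $\mathcal{O}(\mathbb{D}^n)$. For $Q(z)=\sum_{\alpha}a_\alpha z^\alpha\in\mathbb{C}[z_1,\dots,z_n]$: $\mathrm{supp}(Q)$ is the set of multi-indices $\alpha\in\mathbb{N}^n$ ($0$ included in $\mathbb{N}$) with $\frac{\partial^{|\alpha|} Q}{\partial z^\alpha}(0)\neq0$ (equivalently $a_\alpha\neq0$); $\widetilde{Q}(z):=\sum_\alpha\overline{a_\alpha}z^\alpha$ and $\widetilde{Q}(\frac1z):=\sum_\alpha\overline{a_\alpha}\frac{1}{z^\alpha}$;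 $\nu(Q):=(\nu_1(Q),\dots,\nu_n(Q))$, where $\nu_j(Q)$ is the degree of $Q(b_1,\dots,b_{j-1},\zeta,b_{j+1},\dots,b_n)\in\mathbb{C}[\zeta]$ for generic $(b_1,\dots,b_{j-1},b_{j+1},\dots,b_n)\in\mathbb{C}^{n-1}$ (i.e. the degree of $Q$ in $z_j$). The expression $z^{\nu(Q)}\widetilde{Q}(\frac1z)$ is a polynomial. $Q$ is called deficient in degree if $\nu(Q)\notin\mathrm{supp}(Q)$. *)

(* Defs.v *)
From HB Require Import structures.
From mathcomp Require Import all_boot all_order all_algebra complex.
From mathcomp Require Import all_classical all_reals all_analysis.
(* The notations of mpoly.v clash with those of all_analysis: {mpoly C[n]} is
   written [mpoly n C], and p.@[v] is [meval v p]. *)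
From mathcomp Require Import -(notations) mpoly.

Set Implicit Arguments.
Unset Strict Implicit.
Unset Printing Implicit Defensive.

Import Order.TTheory GRing.Theory Num.Theory.
Import numFieldNormedType.Exports.

Local Open Scope classical_set_scope.
Local Open Scope ring_scope.
Local Open Scope complex_scope.

(* The usual topology and norm of C, as a normed space over itself. *)
HB.instance Definition _ (R : realType) := NormedModule.copy R[i] R[i]^o.

Section Polydisc.
Variables (R : realType) (n : nat).
Local Notation C := R[i].

Definition polydisc : set 'rV[C]_n := [set z | forall j, `|z 0 j| < 1].

(* Complex differentiability: source and target are normed spaces over C. *)
Definition holomorphic (f : 'rV[C]_n -> C) : Prop :=
  forall z, polydisc z -> differentiable f z.

Definition bounded_on_polydisc (f : 'rV[C]_n -> C) : Prop :=
  exists M : C, forall z, polydisc z -> `|f z| <= M.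

Definition nonconstant (f : 'rV[C]_n -> C) : Prop :=
  ~ exists c : C, forall z, polydisc z -> f z = c.

(* [f] is invertible in O(D^n). *)
Definition holomorphic_unit (f : 'rV[C]_n -> C) : Prop :=
  holomorphic f /\
  exists2 g, holomorphic g & forall z, polydisc z -> f z * g z = 1.

Definition open_box (a b : 'rV[R]_n) : set 'rV[R]_n :=
  [set t | forall j, a 0 j < t 0 j < b 0 j].

(* Vanishing n-dimensional Lebesgue outer measure. *)
Definition lebesgue_null (A : set 'rV[R]_n) : Prop :=
  forall e : R, 0 < e -> exists a b : nat -> 'rV[R]_n,
    [/\ forall k j, a k 0 j <= b k 0 j,
        A `<=` \bigcup_k open_box (a k) (b k) &
        (\sum_(0 <= k <oo) (\prod_(j < n) (b k 0 j - a k 0 j))%:E <= e%:E)%E].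

Definition torus_point (t : 'rV[R]_n) : 'rV[C]_n :=
  \row_j (cos (t 0 j) +i* sin (t 0 j)).

(* The measure on T^n is the image of Lebesgue measure on [0, 2 pi[^n under
   [torus_point]. *)
Definition ae_torus (P : 'rV[C]_n -> Prop) : Prop :=
  lebesgue_null [set t : 'rV[R]_n |
    (forall j, 0 <= t 0 j < 2 * pi) /\ ~ P (torus_point t)].

Definition inner (f : 'rV[C]_n -> C) : Prop :=
  [/\ holomorphic f,
      bounded_on_polydisc f &
      ae_torus (fun w =>
        `|f (r%:C *: w)| @[r --> (1 : R)^'-] --> (1 : C))].

Definition rational (f : 'rV[C]_n -> C) : Prop :=
  exists p q : mpoly n C, q != 0 /\
    forall z, polydisc z -> meval (z 0) q != 0 ->
      f z = meval (z 0) p / meval (z 0) q.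

Definition rational_inner (f : 'rV[C]_n -> C) : Prop := inner f /\ rational f.

Definition irreducible_rational_inner (f : 'rV[C]_n -> C) : Prop :=
  [/\ rational_inner f,
      nonconstant f &
      ~ exists g h, [/\ rational_inner g, rational_inner h,
          ~ holomorphic_unit g, ~ holomorphic_unit h &
          forall z, polydisc z -> f z = g z * h z]].

End Polydisc.

Section Polynomials.
Variables (R : realType) (n : nat).
Local Notation C := R[i].
Implicit Types Q : mpoly n C.

(* Irreducible element of the ring C[z_1, ..., z_n]. *)
Definition irreducible_mpoly Q : Prop :=
  [/\ Q != 0, Q \isn't a GRing.unit &
      forall A B : mpoly n C, Q = A * B ->
        A \is a GRing.unit \/ B \is a GRing.unit].

Definition nu Q : multinom n :=
  Multinom [tuple \max_(m <- msupp Q) (m j : nat) | j < n].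

Definition deficient Q : Prop := nu Q \notin msupp Q.

Definition tilde Q : mpoly n C := map_mpoly (@conjc R) Q.

(* The polynomial z^(nu Q) * (tilde Q)(1/z), see [meval_reflection]. No
   exponent is truncated, since m <= nu Q for every m in the support of Q. *)
Definition reflection Q : mpoly n C :=
  \sum_(m <- msupp Q) (mcoeff m (tilde Q)) *: mpolyX C (mnm_sub (nu Q) m).

Lemma le_nu Q m j : m \in msupp Q -> (m j <= nu Q j)%N.
Proof.
move=> mQ; rewrite /nu /fun_of_multinom /= tnth_mktuple.
by rewrite (bigD1_seq m) ?msupp_uniq //= leq_maxl.
Qed.

Lemma meval_reflection Q (z : 'I_n -> C) : (forall j, z j != 0) ->
  meval z (reflection Q) =
  (\prod_j z j ^+ nu Q j) * meval (fun j => (z j)^-1) (tilde Q).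
Proof.
move=> z0; have conj_inj : injective (@conjc R) by exact: can_inj (@conjcK R).
rewrite /reflection raddf_sum mevalE.
rewrite [in RHS](perm_big _ (msupp_map_mpoly Q conj_inj)) /= mulr_sumr.
rewrite big_seq [RHS]big_seq; apply: eq_bigr => m mQ.
rewrite mevalZ mevalX mulrCA -big_split /=; congr (_ * _).
apply: eq_bigr => j _; rewrite exprVn mnmE expfB_cond ?le_nu //.
by rewrite (negbTE (z0 j)) add0n le_nu.
Qed.

End Polynomials.

(* Main.v *)
From HB Require Import structures.
Require Import Defs.
From mathcomp Require Import all_boot all_order all_algebra complex.
From mathcomp Require Import all_classical all_reals all_analysis.
From mathcomp Require Import -(notations) mpoly.
From mathcomp Require Import measurable_realfun.
From mathcomp Require Import zify ring lra.


(** Write Q^ for the reflection z^nu(Q) conj(Q)(1/z) of a polynomial Q.  The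
proof goes through the canonical form of a rational inner function,
f = c z^m Q^ / Q with c unimodular and Q free of zeros in the polydisc
([rational_inner_form]), and then reads the conclusion off irreducibility.

To get that form, take f = P / Q in lowest terms.  Polynomials over C form a
factorial ring ([factorial_mpoly]), and an irreducible q that vanishes somewhere
in D^n divides every polynomial vanishing on the zeros of q in D^n
([prime_zero_divides]): eliminate one variable between the two and use that
roots move continuously.  As P = f Q vanishes wherever Q does, Q has no zero in
D^n.  The radial limits give |P| = |Q| at almost every point of the torus, and a
nonzero polynomial cannot vanish on the complement in the torus of a null set
([null_avoid]), so P P* = Q Q* holds between polynomials, where the star is the
reflection with respect to a common exponent ([torus_identity]).  Unique
factorization turns this into P* = S Q with S a divisor of a monomial, hence
P = c z^m Q^.

Conversely each c z^m A^ / A with A zero-free is rational inner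
([rational_inner_quotient]).  It is bounded by 1: pulling A back along a product
of Moebius maps turns |A^(z)| <= |A(z)| into the fact that the leading
coefficient of a one-variable polynomial without zeros in D is dominated by its
constant term ([norm_reflection_le]).  Its radial limits have modulus 1 at every
point of the torus, because a possible zero of A at the endpoint of a radius
cancels against the same zero of A^ ([radial_limit]).  Moreover c z^m A^ / A is
a unit only if m = 0 and A^ is zero-free, and then A^ is a constant multiple
of A ([reflection_unit]): along each radial line all the roots of A have
modulus 1.

Finally choose the form f = c z^m Q^ / Q with Q of least degree.  If m is not 0,
a factor z_j splits off, and irreducibility makes the rest constant.  If m = 0,
a factorization Q = A B gives f = c (A^ / A) (B^ / B); one factor must be a unit,
hence constant, which contradicts the minimality of Q unless A or B is constant.
And f(0) = 0 says that the coefficient of Q at nu(Q) vanishes. *)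

Set Implicit Arguments.
Unset Strict Implicit.
Unset Printing Implicit Defensive.

Import Order.TTheory GRing.Theory Num.Theory.
Import numFieldNormedType.Exports.

Local Open Scope ring_scope.
Local Open Scope complex_scope.

(** * Unique factorization in polynomial rings *)

Section Divisibility.
Variable R : idomainType.
Implicit Types a b c p : R.

Definition divides a b : Prop := exists c, b = c * a.

Definition prime_elt p : Prop :=
  [/\ p != 0, p \isn't a GRing.unit &
      forall a b, divides p (a * b) -> divides p a \/ divides p b].

Definition prime_product (x : R) : Prop := exists u s,
  [/\ u \is a GRing.unit, forall p, p \in s -> prime_elt p &
      x = u * \prod_(p <- s) p].

Definition factorial_ring : Prop := forall x : R, x != 0 -> prime_product x.

Lemma divides_mull a b c : divides a b -> divides a (c * b).
Proof. by case=> d ->; exists (c * d); rewrite mulrA. Qed.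

Lemma divides_mulr a b c : divides a b -> divides a (b * c).
Proof. by rewrite mulrC; apply: divides_mull. Qed.

Lemma divides_add a b c : divides a b -> divides a c -> divides a (b + c).
Proof. by case=> d -> [e ->]; exists (d + e); rewrite mulrDl. Qed.

Lemma divides_opp a b : divides a b -> divides a (- b).
Proof. by case=> d ->; exists (- d); rewrite mulNr. Qed.

Lemma divides0 a : divides a 0.
Proof. by exists 0; rewrite mul0r. Qed.

Lemma divides_refl a : divides a a.
Proof. by exists 1; rewrite mul1r. Qed.

Lemma unit_neq0 a : a \is a GRing.unit -> a != 0.
Proof. by apply: contraTneq => ->; rewrite unitr0. Qed.

Lemma prime_elt_Ndivides_unit p a :
  prime_elt p -> a \is a GRing.unit -> ~ divides p a.
Proof.
move=> [_ pU _] aU [c ac]; move: aU; rewrite ac unitrM (negPf pU).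
by rewrite andbF.
Qed.

Lemma prime_elt_divides_prod p (s : seq R) :
  prime_elt p -> divides p (\prod_(q <- s) q) ->
  exists2 q, q \in s & divides p q.
Proof.
move=> pp; elim: s => [|q s IHs].
  by rewrite big_nil => /prime_elt_Ndivides_unit []//; exact: unitr1.
rewrite big_cons; case: (pp) => _ _ /[apply] -[pq|/IHs [r rs pr]].
  by exists q; rewrite ?mem_head.
by exists r; rewrite // inE rs orbT.
Qed.

Lemma prime_elt_irreducible p a b :
  prime_elt p -> p = a * b -> a \is a GRing.unit \/ b \is a GRing.unit.
Proof.
move=> [p0 _ pP] pab.
have [] : divides p a \/ divides p b by apply: pP; rewrite -pab; apply: divides_refl.
- case=> c ac; right; apply/unitrP; exists c.
  have : c * b * p = 1 * p by rewrite mul1r mulrAC -ac.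
  by move/(mulIf p0) => cb; rewrite [b * c]mulrC.
- case=> c bc; left; apply/unitrP; exists c.
  have : c * a * p = 1 * p by rewrite mul1r mulrAC -bc mulrC -pab.
  by move/(mulIf p0) => ca; rewrite [a * c]mulrC.
Qed.

Lemma factorial_ind (P : R -> Prop) : factorial_ring ->
  (forall u, u \is a GRing.unit -> P u) ->
  (forall p c, prime_elt p -> c != 0 -> P c -> P (p * c)) ->
  forall c, c != 0 -> P c.
Proof.
move=> ufd Pu Pp c /ufd [u [s [uU sP ->]]] {c}.
have u0 := unit_neq0 uU.
elim: s sP => [|p s IHs] sP; first by rewrite big_nil mulr1; apply: Pu.
have sP' : forall q, q \in s -> prime_elt q.
  by move=> q qs; apply: sP; rewrite inE qs orbT.
rewrite big_cons mulrCA; apply: Pp; [by apply: sP; rewrite mem_head| |exact: IHs].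
rewrite mulf_neq0 //; rewrite big_seq prodf_seq_neq0; apply/allP => q _.
by apply/implyP => /sP' [].
Qed.

Lemma prime_productM a b :
  prime_product a -> prime_product b -> prime_product (a * b).
Proof.
move=> [u [s [uU sP ->]]] [v [t [vU tP ->]]]; exists (u * v), (s ++ t); split.
- by rewrite unitrM uU.
- by move=> p; rewrite mem_cat => /orP [/sP|/tP].
- by rewrite big_cat /= mulrACA.
Qed.

End Divisibility.

Section PolyFactorial.
Variable R : idomainType.
Implicit Types (p c : R) (f g h : {poly R}).

(** If p divides neither leading coefficient, it does not divide their product,
which is the leading coefficient of f g; otherwise the leading term that p
divides can be dropped without changing f g modulo p. *)
Lemma prime_elt_polyC p : prime_elt p -> prime_elt p%:P.
Proof.
move=> pp; case: (pp) => p0 pU pP; split.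
- by rewrite polyC_eq0.
- by rewrite poly_unitE size_polyC p0 /= coefC eqxx.
move=> f g; have [k] := ubnP (size f + size g).
elim: k f g => // k IHk f g szk pfg.
have [->|f0] := eqVneq f 0; first by left; apply: divides0.
have [->|g0] := eqVneq g 0; first by right; apply: divides0.
have strip (h : {poly R}) : h != 0 -> divides p (lead_coef h) ->
  exists2 h' : {poly R}, (size h' < size h)%N & exists d, h = h' + d * p%:P.
  move=> h0 [d dh]; exists (h - lead_coef h *: 'X^((size h).-1)).
    rewrite -[leqRHS](prednK (_ : 0 < size h)%N) ?size_poly_gt0 // ltnS.
    apply/leq_sizeP => j; rewrite coefB coefZ coefXn leq_eqVlt => /orP[/eqP<-|jh].
      by rewrite eqxx mulr1 lead_coefE subrr.
    rewrite gtn_eqF // mulr0 subr0 nth_default //.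
    by rewrite -[leqLHS](prednK (_ : 0 < size h)%N) ?size_poly_gt0.
  exists (d%:P * 'X^((size h).-1)); rewrite mulrAC -polyCM -dh mul_polyC.
  by rewrite subrK.
have [] : divides p (lead_coef f) \/ divides p (lead_coef g).
  apply: pP; case: pfg => d; rewrite -lead_coefM => ->.
  by rewrite lead_coefM lead_coefC; exists (lead_coef d).
- case/(strip _ f0) => f' szf [d fE].
  have [] := IHk f' g.
  + by rewrite -ltnS; apply: leq_trans szk; rewrite ltnS ltn_add2r.
  + have -> : f' * g = f * g - d * g * p%:P by rewrite fE; ring.
    by apply: divides_add => //; apply: divides_opp; apply/divides_mull/divides_refl.
  + move=> pf; left; rewrite fE; apply: divides_add => //.
    by apply/divides_mull/divides_refl.
  + by right.
- case/(strip _ g0) => g' szg [d gE].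
  have [] := IHk f g'.
  + by rewrite -ltnS; apply: leq_trans szk; rewrite ltnS ltn_add2l.
  + have -> : f * g' = f * g - f * d * p%:P by rewrite gE; ring.
    by apply: divides_add => //; apply: divides_opp; apply/divides_mull/divides_refl.
  + by left.
  + move=> pf; right; rewrite gE; apply: divides_add => //.
    by apply/divides_mull/divides_refl.
Qed.

Definition primitive_poly f : Prop :=
  forall p, prime_elt p -> ~ divides p%:P f.

Lemma Ndivides_polyC f c :
  (1 < size f)%N -> c != 0 -> ~ divides f c%:P.
Proof.
move=> szf c0 [d cd]; have d0 : d != 0.
  by apply: contra_neq c0 => d0; apply/eqP; rewrite -polyC_eq0 cd d0 mul0r.
have f0 : f != 0 by rewrite -size_poly_gt0 ltnW.
have := congr1 (fun q : {poly R} => size q) cd; rewrite size_polyC c0 size_mul //.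
move: szf d0; rewrite -size_poly_gt0; case: (size f) => [|[|m]] //.
by case: (size d) => // l _ _; rewrite addnS addSn addnS.
Qed.

(** Elimination of the variable.  The pseudo-gcd of f and g, computed over the
fraction field, is constant: a nonconstant one would be f itself up to a factor
in R, and primality of f clears that factor, so f would divide g. *)
Lemma prime_bezout f g : prime_elt f -> (1 < size f)%N -> ~ divides f g ->
  exists2 c, c != 0 & exists S T, c%:P = S * g + T * f.
Proof.
move=> [f0 fU fP] szf fg; set d := gcdp f g.
have d0 : d != 0 by rewrite gcdp_eq0 (negPf f0).
have [d1|d1] := eqVneq (size d) 1%N.
  have [[u v] /= /eqpP[[c1 c2] /= /andP[c10 c20] E]] := Bezoutp f g.
  have [e e0 de] : exists2 e, e != 0 & d = e%:P.
    by move/eqP: d1 => /size_poly1P.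
  exists (c2 * e); first by rewrite mulf_neq0.
  exists (c1 *: v), (c1 *: u); rewrite polyCM mul_polyC -de -E.
  by rewrite scalerDr -!scalerAl addrC.
have szd : (1 < size d)%N by rewrite ltn_neqAle eq_sym d1 size_poly_gt0.
have [[c h] /= c0 cf] := Pdiv.Idomain.dvdpP _ _ (dvdp_gcdl f g).
have [[c' h'] /= c'0 cg] := Pdiv.Idomain.dvdpP _ _ (dvdp_gcdr f g).
have [[k hk]|[k dk]] : divides f h \/ divides f d.
  by apply: fP; rewrite -cf -mul_polyC; apply/divides_mull/divides_refl.
  case: (@Ndivides_polyC d c szd c0); exists k.
  by apply: (mulIf f0); rewrite mul_polyC cf hk mulrAC.
case: fg; have : divides f (c'%:P * g).
  by rewrite mul_polyC cg; exists (h' * k); rewrite -/d dk mulrA.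
by case/fP => // /Ndivides_polyC; case.
Qed.

Hypothesis ufd : factorial_ring R.

(** Gauss's lemma, first form: a constant factor is removed one prime at a time,
since no prime constant divides a primitive f. *)
Lemma clear_factor f : primitive_poly f ->
  forall c, c != 0 -> forall g k, c%:P * g = k * f -> divides f g.
Proof.
move=> fprim; apply: (factorial_ind
  (P := fun c => forall g k, c%:P * g = k * f -> divides f g) ufd)
  => [u uU|p c pp c0 IHc] g k E.
  by exists (u^-1%:P * k); rewrite -mulrA -E mulrA -polyCM mulVr // mul1r.
have [_ _ pP] := prime_elt_polyC pp.
have [[k' kE]|/(fprim _ pp)//] : divides p%:P k \/ divides p%:P f.
  apply: pP; rewrite -E polyCM -mulrA; apply/divides_mulr/divides_refl.
apply: (IHc g k'); have p0 : p%:P != 0 by rewrite polyC_eq0; case: pp.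
by apply: (mulfI p0); rewrite mulrA -polyCM E kE; ring.
Qed.

(** Gauss's lemma, second form: a factorization over the fraction field descends
to R without changing the degrees. *)
Lemma clear_product c : c != 0 -> forall f g h, c%:P * f = g * h ->
  exists g' h', [/\ f = g' * h', size g' = size g & size h' = size h].
Proof.
move: c; apply: (factorial_ind (P := fun c => forall f g h, c%:P * f = g * h ->
  exists g' h', [/\ f = g' * h', size g' = size g & size h' = size h]) ufd)
  => [u uU|p c pp c0 IHc] f g h E.
  exists (u^-1%:P * g), h; split=> //.
    by rewrite -mulrA -E mulrA -polyCM mulVr // mul1r.
  by rewrite mul_polyC size_scale // invr_eq0 unit_neq0.
have p0 : p%:P != 0 by rewrite polyC_eq0; case: pp.
have szp k : size (k * p%:P) = size k.
  by rewrite mulrC mul_polyC size_scale //; case: pp.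
have [_ _ pP] := prime_elt_polyC pp.
have [[k kE]|[k kE]] : divides p%:P g \/ divides p%:P h.
  by apply: pP; rewrite -E polyCM -mulrA; apply/divides_mulr/divides_refl.
- have [|g' [h' [fE sg sh]]] := IHc f k h.
    by apply: (mulfI p0); rewrite mulrA -polyCM E kE; ring.
  by exists g', h'; rewrite fE sg sh kE szp.
- have [|g' [h' [fE sg sh]]] := IHc f g k.
    by apply: (mulfI p0); rewrite mulrA -polyCM E kE; ring.
  by exists g', h'; rewrite fE sg sh kE szp.
Qed.

Lemma primitive_divisor f g h : primitive_poly f -> f = g * h ->
  primitive_poly g /\ primitive_poly h.
Proof.
move=> fprim fE; split=> p pp pd; apply: (fprim p pp); rewrite fE.
- exact: divides_mulr.
- exact: divides_mull.
Qed.

Lemma primitive_polyC f : f != 0 -> primitive_poly f -> (size f <= 1)%N ->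
  f \is a GRing.unit.
Proof.
move=> f0 fprim /size1_polyC fE; move: f0 fprim; rewrite fE polyC_eq0.
move: (f`_0) => c {f fE} c0 fprim; have [u [[|p s] [uU sP cE]]] := ufd c0.
  rewrite cE big_nil mulr1 poly_unitE size_polyC coefC eqxx uU andbT.
  by rewrite unit_neq0.
exfalso; have /fprim [] : prime_elt p by apply: sP; rewrite mem_head.
exists (u * \prod_(j <- s) j)%:P; rewrite -polyCM cE big_cons.
by congr polyC; ring.
Qed.

(** Euclid's lemma.  The pseudo-gcd of f and a is either constant, and then
Bezout's identity multiplied by b gives f | b up to a constant, or associated to
f, and then f | a up to a constant. *)
Lemma primitive_irreducible_prime f : (1 < size f)%N -> primitive_poly f ->
  (forall g h, f = g * h -> (size g <= 1)%N \/ (size h <= 1)%N) -> prime_elt f.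
Proof.
move=> szf fprim firr; have f0 : f != 0 by rewrite -size_poly_gt0 ltnW.
split=> //.
  by rewrite poly_unitE gtn_eqF.
move=> a b [t fab]; have [fa|fa] := pselect (divides f a); first by left.
right; set d := gcdp f a.
have d0 : d != 0 by rewrite gcdp_eq0 (negPf f0).
have [[c h] /= c0 cf] := Pdiv.Idomain.dvdpP _ _ (dvdp_gcdl f a).
have [[c' h'] /= c'0 ca] := Pdiv.Idomain.dvdpP _ _ (dvdp_gcdr f a).
have [d1|d1] := eqVneq (size d) 1%N.
  have [[u v] /= /eqpP[[c1 c2] /= /andP[c10 c20] E]] := Bezoutp f a.
  have [e e0 de] : exists2 e, e != 0 & d = e%:P by move/eqP: d1 => /size_poly1P.
  apply: (@clear_factor f fprim (c2 * e) _ b (c1%:P * (u * b + v * t))) => //.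
    by rewrite mulf_neq0.
  rewrite polyCM (mul_polyC c2) -de -E -mul_polyC.
  transitivity (c1%:P * (u * f * b + v * (a * b))); first ring.
  by rewrite fab; ring.
have szd : (1 < size d)%N by rewrite ltn_neqAle eq_sym d1 size_poly_gt0.
case: fa; move: cf; rewrite -mul_polyC => cf.
have [g1 [h1 [fE szg1 szh1]]] := clear_product c0 cf.
have h0 : h != 0.
  apply: contra_eq_neq cf => ->; rewrite mul0r mulf_neq0 // polyC_eq0 //.
have szh : (size h <= 1)%N.
  case: (firr _ _ fE); first by rewrite szg1.
  by rewrite szh1 leqNgt szd.
have hE := size1_polyC szh.
apply: (@clear_factor f fprim (h`_0 * c') _ a (h' * c%:P)) => //.
  by rewrite mulf_neq0 //; move: h0; rewrite hE polyC_eq0 coefC eqxx.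
rewrite polyCM -hE -mulrA (mul_polyC c') ca -/d.
by rewrite -mulrA cf -/d; ring.
Qed.

(** Each prime constant taken out of f also leaves the leading coefficient, whose
number of prime factors bounds the process. *)
Lemma content_primitive f : f != 0 ->
  exists2 c, c != 0 & exists2 g, primitive_poly g & f = c%:P * g.
Proof.
move=> f0; have := f0; rewrite -lead_coef_eq0 => /ufd [u [s [uU sP]]].
have [k] := ubnP (size s); elim: k s f f0 u uU sP => // k IHk s f f0 u uU sP szs lf.
have [fprim|/existsNP [p /not_implyP [pp /contrapT [g fE]]]] :=
  pselect (primitive_poly f).
  by exists 1; rewrite ?oner_neq0 //; exists f; rewrite ?mul1r.
have lfE : lead_coef f = lead_coef g * p by rewrite fE lead_coefM lead_coefC.
have g0 : g != 0 by apply: contra_neq f0 => g0; rewrite fE g0 mul0r.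
have [q qs [t qE]] : exists2 q, q \in s & divides p q.
  apply: prime_elt_divides_prod => //.
  exists (u^-1 * lead_coef g); rewrite -mulrA -lfE lf mulrA mulVr //.
  by rewrite mul1r.
have p0 : p != 0 by case: pp.
have tU : t \is a GRing.unit.
  case: (prime_elt_irreducible (sP _ qs) qE) => // pU.
  by case: pp => _; rewrite pU.
have [||||c c0 [g' g'prim gE]] := IHk (rem q s) g g0 (u * t).
- by rewrite unitrM uU.
- by move=> r /mem_rem /sP.
- by rewrite size_rem //; case: (s) qs szs.
- apply: (mulIf p0); rewrite -lfE lf (big_rem q) //= qE; ring.
by exists (p * c); rewrite ?mulf_neq0 //; exists g' => //; rewrite fE gE polyCM; ring.
Qed.

Lemma factorial_primitive f : f != 0 -> primitive_poly f -> prime_product f.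
Proof.
have [k] := ubnP (size f); elim: k f => // k IHk f szk f0 fprim.
have [sz1|sz1] := leqP (size f) 1.
  by exists f, [::]; rewrite big_nil mulr1; split=> //; exact: primitive_polyC.
have [pf|npf] := pselect (prime_elt f).
  exists 1, [:: f]; rewrite big_seq1 mul1r unitr1; split=> // p.
  by rewrite inE => /eqP ->.
have [g [h [fE szg szh]]] : exists g h,
    [/\ f = g * h, (1 < size g)%N & (1 < size h)%N].
  apply: contrapT => nex; apply: npf; apply: primitive_irreducible_prime => // g h fE.
  have [|szg] := leqP (size g) 1; first by left.
  have [|szh] := leqP (size h) 1; first by right.
  by case: nex; exists g, h.
have [gprim hprim] := primitive_divisor fprim fE.
move: f0 szk; rewrite fE mulf_eq0 negb_or => /andP[g0 h0]; rewrite size_mul // => szk.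
by apply: prime_productM; apply: IHk => //; move: szk szg szh;
  rewrite -subn1; clear; lia.
Qed.

Lemma factorial_poly : factorial_ring {poly R}.
Proof.
move=> f f0; have [c c0 [g gprim fE]] := content_primitive f0.
have g0 : g != 0 by apply: contra_neq f0 => g0; rewrite fE g0 mulr0.
rewrite fE; apply: prime_productM; last exact: factorial_primitive.
have [u [s [uU sP ->]]] := ufd c0; exists u%:P, (map polyC s); split.
- by rewrite poly_unitE size_polyC coefC eqxx uU andbT unit_neq0.
- by move=> _ /mapP [p ps ->]; apply/prime_elt_polyC/sP.
- by rewrite polyCM big_map; congr (_ * _); rewrite rmorph_prod.
Qed.

End PolyFactorial.

Section Irreducible.
Variable R : idomainType.

Lemma prime_elt_unitM (p u : R) :
  u \is a GRing.unit -> prime_elt p -> prime_elt (p * u).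
Proof.
move=> uU [p0 pU pP]; split.
- by rewrite mulf_neq0 // unit_neq0.
- by rewrite unitrM (negPf pU).
have lift x : divides p x -> divides (p * u) x.
  by case=> d ->; exists (d * u^-1); rewrite [p * u]mulrC mulrA divrK.
move=> a b [c ab]; have [] : divides p a \/ divides p b.
- by apply: pP; exists (c * u); rewrite ab [p * u]mulrC mulrA.
- by move=> /lift; left.
- by move=> /lift; right.
Qed.

Lemma irreducible_prime_elt (x : R) : factorial_ring R ->
  x != 0 -> x \isn't a GRing.unit ->
  (forall a b, x = a * b -> a \is a GRing.unit \/ b \is a GRing.unit) ->
  prime_elt x.
Proof.
move=> ufd x0 xU irr; have [u [[|p s] [uU sP xE]]] := ufd x x0.
  by move: xU; rewrite xE big_nil mulr1 uU.
have pp : prime_elt p by apply: sP; rewrite mem_head.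
move: xE; rewrite big_cons mulrCA => xE.
have [|vU] := irr _ _ xE; first by case: pp => _ /negPf->.
by rewrite xE; apply: prime_elt_unitM.
Qed.

End Irreducible.

(** * Multivariate polynomials one variable at a time *)

Section Transport.
Variables (A B : idomainType) (f : {rmorphism A -> B}) (g : {rmorphism B -> A}).
Hypotheses (fK : cancel f g) (gK : cancel g f).

Lemma prime_elt_iso p : prime_elt p -> prime_elt (f p).
Proof.
move=> [p0 pU pP]; split.
- by rewrite -(rmorph0 f) (inj_eq (can_inj fK)).
- by apply: contra pU => /(rmorph_unit g); rewrite fK.
move=> a b [c ab]; have [] : divides p (g a) \/ divides p (g b).
- by apply: pP; exists (g c); rewrite -rmorphM ab rmorphM fK.
- by case=> d ad; left; exists (f d); rewrite -rmorphM -ad gK.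
- by case=> d ad; right; exists (f d); rewrite -rmorphM -ad gK.
Qed.
End Transport.

Lemma factorial_iso (A B : idomainType) (f : {rmorphism A -> B})
    (g : {rmorphism B -> A}) : cancel f g -> cancel g f ->
  factorial_ring A -> factorial_ring B.
Proof.
move=> fK gK ufd x x0.
have gx0 : g x != 0 by rewrite -(rmorph0 g) (inj_eq (can_inj gK)).
have [u [s [uU sP gx]]] := ufd _ gx0; exists (f u), (map f s); split.
- exact: rmorph_unit.
- by move=> _ /mapP[p /sP pp ->]; apply: (prime_elt_iso fK gK).
- by rewrite -[LHS]gK gx rmorphM rmorph_prod big_map.
Qed.

Lemma mpoly_ring_ind n (F : comNzRingType) (P : mpoly n F -> Prop) :
  (forall c, P (mpolyC n c)) -> (forall i, P (mpolyX F (mnm1 i))) ->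
  (forall p q, P p -> P q -> P (p + q)) ->
  (forall p q, P p -> P q -> P (p * q)) -> forall p, P p.
Proof.
move=> PC PX PD PM; have P0 : P 0 by rewrite -(rmorph0 (@mpolyC n F)); apply: PC.
have P1 : P 1 by rewrite -(rmorph1 (@mpolyC n F)); apply: PC.
elim/mpolyind => // c m p _ _ Pp; apply: (PD _ _ _ Pp).
rewrite -mul_mpolyC; apply: (PM) => //.
rewrite mpolyXE_id; apply: big_ind => [//||i _]; first exact: PM.
by elim: (m i) => [|k IHk]; rewrite ?expr0 // exprS; apply: PM.
Qed.

Lemma mpoly_morph_ext n (F : comNzRingType) (S : nzRingType)
    (f g : {rmorphism mpoly n F -> S}) :
  (forall c, f (mpolyC n c) = g (mpolyC n c)) ->
  (forall i, f (mpolyX F (mnm1 i)) = g (mpolyX F (mnm1 i))) -> f =1 g.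
Proof.
move=> fgC fgX; apply: mpoly_ring_ind => // p q fp fq.
- by rewrite !rmorphD fp fq.
- by rewrite !rmorphM fp fq.
Qed.

Definition subst_at (n : nat) (T : Type) (k : 'I_n) (x : T) (v : 'I_n -> T) :
  'I_n -> T := fun j => if j == k then x else v j.

Definition insert_at (n : nat) (T : Type) (k : 'I_n.+1) (x : T) (v : 'I_n -> T) :
  'I_n.+1 -> T := fun j => if unlift k j is Some i then v i else x.

Section Slice.
Variables (F : numClosedFieldType) (n : nat) (k : 'I_n.+1).
Local Notation P1 := (mpoly n.+1 F).
Local Notation P0 := (mpoly n F).

(** The isomorphism F[z_0, ..., z_n] = F[z_j, j != k][z_k]; any variable can
play the role of the main one. *)
Definition slice : P1 -> {poly P0} :=
  mmap (polyC \o @mpolyC n F)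
    (insert_at k 'X (fun i => (mpolyX F (mnm1 i))%:P)).
HB.instance Definition _ := GRing.RMorphism.on slice.

Definition widen_at : P0 -> P1 :=
  mmap (@mpolyC n.+1 F) (fun i => mpolyX F (mnm1 (lift k i))).
HB.instance Definition _ := GRing.RMorphism.on widen_at.

Definition unslice : {poly P0} -> P1 :=
  horner_eval (mpolyX F (mnm1 k)) \o map_poly widen_at.
HB.instance Definition _ := GRing.RMorphism.on unslice.

Lemma sliceC c : slice (mpolyC _ c) = (mpolyC _ c)%:P.
Proof. exact: mmapC. Qed.

Lemma sliceX j : slice (mpolyX F (mnm1 j)) =
  insert_at k 'X (fun i => (mpolyX F (mnm1 i))%:P) j.
Proof. by rewrite /slice mmapX mmap1U. Qed.

Lemma widen_atX i : widen_at (mpolyX F (mnm1 i)) = mpolyX F (mnm1 (lift k i)).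
Proof. by rewrite /widen_at mmapX mmap1U. Qed.

Lemma sliceK : cancel slice unslice.
Proof.
apply: (mpoly_morph_ext (f := unslice \o slice) (g := idfun)) => [c|j] /=.
  by rewrite sliceC /unslice /= map_polyC /= /horner_eval hornerC /widen_at mmapC.
rewrite sliceX /insert_at; case: unliftP => [i ->|->].
  by rewrite /unslice /= map_polyC /= /horner_eval hornerC widen_atX.
by rewrite /unslice /= map_polyX /horner_eval hornerX.
Qed.

Lemma slice_widen p : slice (widen_at p) = p%:P.
Proof.
apply: (mpoly_morph_ext (f := slice \o widen_at) (g := polyC)) => [c|i] /=.
  by rewrite /widen_at mmapC sliceC.
by rewrite widen_atX sliceX /insert_at liftK.
Qed.

Lemma unsliceK : cancel unslice slice.
Proof.
move=> p; rewrite /unslice /= /horner_eval.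
elim/poly_ind: p => [|p c IHp]; first by rewrite rmorph0 horner0 rmorph0.
rewrite rmorphD rmorphM /= map_polyX map_polyC /= hornerMXaddC.
by rewrite rmorphD rmorphM /= IHp slice_widen sliceX /insert_at unlift_none.
Qed.

Lemma meval_slice (v : 'I_n -> F) x p :
  (map_poly (meval v) (slice p)).[x] = meval (insert_at k x v) p.
Proof.
apply: (mpoly_morph_ext
  (f := horner_eval x \o map_poly (meval v) \o slice)
  (g := meval (insert_at k x v))) => [c|j] /=.
  by rewrite sliceC map_polyC /= /horner_eval hornerC !mevalC.
rewrite sliceX mevalXU /insert_at /horner_eval; case: unliftP => [i _|_].
  by rewrite map_polyC /= hornerC mevalXU.
by rewrite map_polyX hornerX.
Qed.

Lemma prime_elt_slice p : prime_elt p -> prime_elt (slice p).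
Proof.
pose f : {rmorphism P1 -> {poly P0}} := slice.
pose g : {rmorphism {poly P0} -> P1} := unslice.
have fK : cancel f g by move=> x; apply: sliceK.
have gK : cancel g f by move=> x; apply: unsliceK.
exact: (prime_elt_iso fK gK).
Qed.

End Slice.

Section Points.
Variable F : numClosedFieldType.

Theorem factorial_mpoly n : factorial_ring (mpoly n F).
Proof.
elim: n => [|n IHn].
  move=> p p0; exists p, [::]; rewrite big_nil mulr1; split=> //.
  apply/unitrP; exists (mpolyC 0 (mcoeff mnm0 p)^-1).
  have pE := mpolyKC p; have c0 : mcoeff mnm0 p != 0.
    by rewrite -(mpolyC_eq0 0) pE.
  by rewrite -{2 3}pE -!rmorphM /= mulVf // mulfV // rmorph1.
pose f : {rmorphism {poly mpoly n F} -> mpoly n.+1 F} := @unslice F n ord_max.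
pose g : {rmorphism mpoly n.+1 F -> {poly mpoly n F}} := @slice F n ord_max.
have ufd : factorial_ring {poly mpoly n F} by apply: factorial_poly.
have fK : cancel f g by move=> x; apply: unsliceK.
have gK : cancel g f by move=> x; apply: sliceK.
exact: (factorial_iso fK gK ufd).
Qed.

Definition infinite_pred (S : F -> Prop) : Prop :=
  forall s : seq F, exists2 x, S x & x \notin s.

Lemma infinite_nonroot (S : F -> Prop) (g : {poly F}) :
  infinite_pred S -> g != 0 -> exists2 x, S x & g.[x] != 0.
Proof.
move=> Sinf g0; have [s gE] := closed_field_poly_normal g.
have [x Sx xs] := Sinf s; exists x => //.
by rewrite gE hornerZ mulf_neq0 ?lead_coef_eq0 // -[_ == 0]/(root _ x) root_prod_XsubC.
Qed.

Lemma injective_infinite (S : F -> Prop) (u : nat -> F) :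
  injective u -> (forall k, S (u k)) -> infinite_pred S.
Proof.
move=> uI Su s; apply: contrapT => nex.
have us : {subset mkseq u (size s).+1 <= s}.
  move=> _ /mapP[k _ ->]; apply/negPn/negP => uks; apply: nex.
  by exists (u k).
have : uniq (mkseq u (size s).+1) by rewrite mkseq_uniq.
move=> /uniq_leq_size /(_ us).
by rewrite size_mkseq ltnn.
Qed.

Lemma infinite_predT : infinite_pred (fun _ => True).
Proof.
by apply: (@injective_infinite _ (fun k => k%:R)) => // k l /eqP; rewrite eqr_nat => /eqP.
Qed.

Lemma infinite_ball (a e : F) : 0 < e -> infinite_pred (fun x => `|x - a| < e).
Proof.
move=> e0; apply: (@injective_infinite _ (fun k => a + e / k.+2%:R)).
  move=> k l /addrI/(mulfI (lt0r_neq0 e0))/invr_inj/eqP.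
  by rewrite eqr_nat => /eqP [].
move=> k; rewrite addrC addKr normrM gtr0_norm // normfV ger0_norm ?ler0n //.
by rewrite ltr_pdivrMr ?ltr0n // ltr_pMr // ltr1n.
Qed.

Lemma mpoly_nonzero_point n (p : mpoly n F) : p != 0 -> exists v, meval v p != 0.
Proof.
elim: n p => [|n IHn] p p0.
  exists (fun=> 0); rewrite -[p]mpolyKC mevalC.
  by apply: contra_neq p0 => c0; rewrite -[p]mpolyKC c0 mpolyC0.
have sp0 : slice ord0 p != 0.
  by rewrite -(rmorph0 (@slice F n ord0)) (inj_eq (can_inj (@sliceK F n ord0))).
have [v v0] : exists v, meval v (lead_coef (slice ord0 p)) != 0.
  by apply: IHn; rewrite lead_coef_eq0.
have g0 : map_poly (meval v) (slice ord0 p) != 0.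
  apply: contra_neq v0 => g0; rewrite lead_coefE.
  by rewrite -(coef_map (meval v)) g0 coef0.
have [x _ gx] := infinite_nonroot infinite_predT g0.
by exists (insert_at ord0 x v); rewrite -meval_slice.
Qed.

Definition line n (v : 'I_n -> F) (k : 'I_n) : mpoly n F -> {poly F} :=
  mmap polyC (subst_at k 'X (fun j => (v j)%:P)).
HB.instance Definition _ n v k := GRing.RMorphism.on (@line n v k).

Lemma horner_line n (v : 'I_n -> F) k p x :
  (line v k p).[x] = meval (subst_at k x v) p.
Proof.
apply: (mpoly_morph_ext (f := horner_eval x \o line v k)
  (g := meval (subst_at k x v))) => [c|j] /=.
  by rewrite /line mmapC /horner_eval hornerC mevalC.
rewrite /line mmapX mmap1U mevalXU /horner_eval /subst_at.
by case: eqP => _; rewrite ?hornerX ?hornerC.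
Qed.

Lemma subst_at_id n (v : 'I_n -> F) k : subst_at k (v k) v =1 v.
Proof. by move=> j; rewrite /subst_at; case: eqP => // ->. Qed.

Lemma line_neq0 n (v : 'I_n -> F) k p : meval v p != 0 -> line v k p != 0.
Proof.
apply: contra_neq => l0; rewrite -(meval_eq _ (subst_at_id v k)) -horner_line l0.
exact: horner0.
Qed.

(** Starting from any point where p is nonzero, the coordinates are moved into
the sets S j one after the other, avoiding the finitely many roots of the
restriction of p to a coordinate line. *)
Lemma mpoly_nonzero_in n (S : 'I_n -> F -> Prop) (p : mpoly n F) :
  (forall j, infinite_pred (S j)) -> p != 0 ->
  exists2 v, forall j, S j (v j) & meval v p != 0.
Proof.
move=> Sinf p0.
suff /(_ n (leqnn n)) [v Sv vp] : forall m, (m <= n)%N ->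
    exists2 v, forall j : 'I_n, (j < m)%N -> S j (v j) & meval v p != 0.
  by exists v => // j; apply: Sv.
elim=> [_|m IHm mn]; first by have [v vp] := mpoly_nonzero_point p0; exists v.
have [v Sv vp] := IHm (ltnW mn); pose k := Ordinal mn.
have [x Sx xp] := infinite_nonroot (Sinf k) (line_neq0 k vp).
exists (subst_at k x v); last by rewrite -horner_line.
move=> j; rewrite /subst_at ltnS leq_eqVlt; have [-> //|jk] := eqVneq j k.
by move=> /orP[/eqP jm|]; [case/eqP: jk; apply: val_inj|apply: Sv].
Qed.

End Points.

(** * Irreducible polynomials with a zero in the polydisc *)

Section Analytic.
Variables (R : realType) (n : nat).
Local Notation C := R[i].
Implicit Types (p q : mpoly n C) (z : 'rV[C]_n).

Lemma differentiable_meval p z : differentiable (fun x : 'rV[C]_n => meval (x 0) p) z.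
Proof.
elim/mpoly_ring_ind: p => [c|i|p q dp dq|p q dp dq].
- rewrite (_ : (fun _ => _) = cst c); first exact: differentiable_cst.
  by apply/funext => x; rewrite mevalC.
- rewrite (_ : (fun _ => _) = fun x : 'rV[C]_n => x 0 i); first exact: differentiable_coord.
  by apply/funext => x; rewrite mevalXU.
- rewrite (_ : (fun _ => _) = (fun x : 'rV[C]_n => meval (x 0) p) + (fun x : 'rV[C]_n => meval (x 0) q)).
    exact: differentiableD.
  by apply/funext => x; rewrite mevalD.
- rewrite (_ : (fun _ => _) = (fun x : 'rV[C]_n => meval (x 0) p) * (fun x : 'rV[C]_n => meval (x 0) q)).
    exact: differentiableM.
  by apply/funext => x; rewrite mevalM.
Qed.

Lemma continuous_meval p z : {for z, continuous (fun x : 'rV[C]_n => meval (x 0) p)}.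
Proof. exact/differentiable_continuous/differentiable_meval. Qed.

Lemma near_norm_lt p z e :
  `|meval (z 0) p| < e -> \forall x \near z, `|meval ((x : 'rV[C]_n) 0) p| < e.
Proof.
by move=> lt; have /cvgr_norm_lt/(_ _ lt) := @continuous_meval p z.
Qed.

Lemma near_norm_gt p z e :
  e < `|meval (z 0) p| -> \forall x \near z, e < `|meval ((x : 'rV[C]_n) 0) p|.
Proof.
by move=> lt; have /cvgr_norm_gt/(_ _ lt) := @continuous_meval p z.
Qed.

Lemma near_polydisc z : polydisc z -> \forall x \near z, polydisc x.
Proof.
move=> z1; rewrite /polydisc /=.
apply: (@filter_forall _ _ (fun j (x : 'rV[C]_n) => `|x 0 j| < 1) (nbhs z) _) => j; have /near_norm_lt : `|meval (z 0) (mpolyX C (mnm1 j))| < 1.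
  by rewrite mevalXU.
by apply: filterS => x; rewrite mevalXU.
Qed.

Lemma near_row (P : 'rV[C]_n -> Prop) z :
  (\forall x \near z, P x) ->
  exists2 d : C, 0 < d & forall v : 'I_n -> C, (forall j, `|v j - z 0 j| < d) -> P (\row_j v j).
Proof.
move=> /nbhs_ballP [d /= d0 dP]; exists d => // v vd; apply: dP; split=> // i j.
by rewrite ord1 mxE -ball_normE /ball_ /= distrC.
Qed.

End Analytic.

Section FarRoots.
Variable F : numClosedFieldType.

(** For a root r with |r - a| >= d one has |y - r| <= (1 + |y - a| / d) |a - r|;
multiply over the roots.  If moreover g(a) is tiny and g(y) is not, some root
must therefore be close to a: this is the continuity of roots. *)
Lemma horner_far_roots (g : {poly F}) a y d : 0 < d ->
  (forall x, root g x -> d <= `|x - a|) ->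
  `|g.[y]| <= (1 + `|y - a| / d) ^+ (size g).-1 * `|g.[a]|.
Proof.
move=> d0 far; have [->|g0] := eqVneq g 0; first by rewrite !horner0 normr0 mulr0.
have [s gE] := closed_field_poly_normal g.
have lg : lead_coef g != 0 by rewrite lead_coef_eq0.
have {}far x : x \in s -> d <= `|x - a|.
  by move=> xs; apply: far; rewrite gE rootZ // root_prod_XsubC.
have -> : (size g).-1 = size s by rewrite gE size_scale // size_prod_XsubC.
rewrite gE !hornerZ !normrM mulrCA ler_wpM2l // {g g0 gE lg}.
elim: s far => [|z s IHs] far; first by rewrite big_nil !hornerC expr0 mul1r.
rewrite big_cons !hornerM !normrM /= exprS mulrACA ler_pM // ?IHs //; last first.
  by move=> x xs; apply: far; rewrite inE xs orbT.
rewrite !hornerXsubC mulrDl mul1r -[y - z](subrKA a) addrC.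
apply: le_trans (ler_normD _ _) _; rewrite lerD2l.
rewrite -mulrA ler_peMr // ler_pdivlMl // mulr1 distrC.
by apply: far; rewrite mem_head.
Qed.

End FarRoots.

Section ZeroSet.
Variable R : realType.
Local Notation C := R[i].

Lemma insert_at_lift n (k : 'I_n.+1) (v : 'I_n.+1 -> C) x :
  insert_at k x (v \o lift k) =1 subst_at k x v.
Proof.
move=> j; rewrite /insert_at /subst_at; case: unliftP => [i ->|->].
  by rewrite eq_sym (negPf (neq_lift _ _)).
by rewrite eqxx.
Qed.

(** If q did not divide p, eliminating z_k would give a nonzero polynomial c in
the other variables lying in the ideal of p and q.  Near v choose values w of the
other variables with c(w) != 0; by continuity q(w, .) still has a root close to
v k, inside the disc.  There q and then p vanish, so c(w) = 0. *)
Lemma slice_prime_zero n (k : 'I_n.+1) (q p : mpoly n.+1 C) v y :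
  prime_elt q -> (forall j, `|v j| < 1) ->
  meval v q = 0 -> meval (subst_at k y v) q != 0 ->
  (forall w, (forall j, `|w j| < 1) -> meval w q = 0 -> meval w p = 0) ->
  divides q p.
Proof.
move=> qp v1 vq yq qpz; apply: contrapT => Nqp.
pose g := slice k q; pose f := slice k p; pose u := v \o lift k.
have evalE w x h : meval w (slice k h).[mpolyC n x] = meval (insert_at k x w) h.
  by rewrite -meval_slice -horner_map /= mevalC.
have uq : meval u g.[mpolyC n (v k)] = 0.
  by rewrite evalE -vq; apply: meval_eq => j; rewrite insert_at_lift subst_at_id.
have uy : meval u g.[mpolyC n y] != 0.
  by rewrite evalE (meval_eq _ (insert_at_lift k v y)).
have szg : (1 < size g)%N.
  rewrite ltnNge; apply: contra_neqN uy => /size1_polyC gE.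
  by rewrite -uq gE !hornerC.
have gp : prime_elt g.
  exact: prime_elt_slice.
have Ngf : ~ divides g f.
  move=> [h fE]; apply: Nqp; exists (unslice k h).
  by rewrite -[LHS](@sliceK _ _ k) -/f fE rmorphM /= sliceK.
have [c c0 [S [T cE]]] := prime_bezout gp szg Ngf.
pose al := `|meval u g.[mpolyC n y]|; have al0 : 0 < al by rewrite normr_gt0.
pose d := 1 - `|v k|; have d0 : 0 < d by rewrite subr_gt0.
(* the factor by which values at v k and y can differ if no root is close to v k *)
pose M := (1 + `|y - v k| / d) ^+ (size g).-1.
have M1 : 1 <= M by rewrite exprn_ege1 // lerDl divr_ge0 // ltW.
have M0 : 0 < M by apply: lt_le_trans M1.
have evalu (h : mpoly n C) : meval ((\row_j u j) 0) h = meval u h.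
  by apply: meval_eq => j; rewrite mxE.
have [e e0 near_u] : exists2 e : C, 0 < e & forall w, (forall j, `|w j - (\row_i u i) 0 j| < e) ->
    [/\ `|meval ((\row_j w j) 0) g.[mpolyC n (v k)]| < al / 2 / M,
        al / 2 < `|meval ((\row_j w j) 0) g.[mpolyC n y]| & polydisc (\row_j w j)].
  apply: (@near_row _ _ (fun x => [/\ `|meval (x 0) _| < _, _ < `|meval (x 0) _| & polydisc x])).
  near=> x; split.
  - by near: x; apply: near_norm_lt; rewrite evalu uq normr0 !divr_gt0.
  - near: x; apply: near_norm_gt; rewrite evalu -/al ltr_pdivrMr //.
    by rewrite ltr_pMr // ltr1n.
  - by near: x; apply: near_polydisc => j; rewrite mxE; apply: v1.
have [w wu wc] := mpoly_nonzero_in (fun j => infinite_ball ((\row_i u i) 0 j) e0) c0.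
have evalw (h : mpoly n C) : meval ((\row_j w j) 0) h = meval w h.
  by apply: meval_eq => j; rewrite mxE.
have [] := near_u w wu; rewrite !evalw => w1 w2 w3 {near_u}.
pose G := map_poly (meval w) g.
have GE x : G.[x] = meval w g.[mpolyC n x] by rewrite evalE -meval_slice.
have [x xG xk] : exists2 x, root G x & `|x - v k| < d.
  apply: contrapT => nex; have far x : root G x -> d <= `|x - v k|.
    move=> Gx; case: real_leP => //; rewrite ?normr_real ?gtr0_real // => xd.
    by case: nex; exists x.
  suff le1 : `|G.[y]| <= al / 2.
    by move: w2; rewrite -GE => /lt_le_trans/(_ le1); rewrite ltxx.
  apply: le_trans (horner_far_roots y d0 far) _.
  have -> : al / 2 = M * (al / 2 / M) by rewrite [RHS]mulrC divfK // gt_eqF.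
  have B1 : 1 <= 1 + `|y - v k| / d by rewrite lerDl divr_ge0 // ltW.
  apply: ler_pM => //; last by rewrite GE ltW.
    by rewrite exprn_ge0 // (le_trans ler01).
  apply: ler_weXn2l => //; rewrite -!subn1 leq_sub2r //.
  by apply/leq_sizeP => j gj; rewrite coef_map /= nth_default ?rmorph0.
have x1 : `|x| < 1.
  rewrite -[x](subrK (v k)); apply: le_lt_trans (ler_normD _ _) _.
  by rewrite -ltrBrDr.
have ww1 j : `|insert_at k x w j| < 1.
  rewrite /insert_at; case: unliftP => // i _; have := w3 i; by rewrite mxE.
have Gx : G.[x] = 0 by apply/eqP.
have fx : (map_poly (meval w) f).[x] = 0.
  rewrite (meval_slice k w x p); apply: qpz => //.
  by rewrite -(meval_slice k w x q).
have wcE : meval w c = (map_poly (meval w) S).[x] * (map_poly (meval w) f).[x] +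
    (map_poly (meval w) T).[x] * G.[x].
  by rewrite -!hornerM -hornerD -!rmorphM -rmorphD /= -cE map_polyC /= hornerC.
move/negP: wc; apply; apply/eqP.
have zero (a b a' b' c' : C) : c' = a * b + a' * b' -> b = 0 -> b' = 0 -> c' = 0.
  by move=> -> -> ->; rewrite !mulr0 addr0.
exact: (zero _ _ _ _ _ wcE fx Gx).
Unshelve. all: by end_near.
Qed.

(** Walk from the zero v of q to a point b with q(b) != 0 by changing one
coordinate at a time: the first coordinate whose change makes q nonzero is a
direction in which q is not identically zero. *)
Lemma prime_zero_divides n (q p : mpoly n C) v :
  prime_elt q -> (forall j, `|v j| < 1) -> meval v q = 0 ->
  (forall w, (forall j, `|w j| < 1) -> meval w q = 0 -> meval w p = 0) ->
  divides q p.
Proof.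
case: n q p v => [|n] q p v qp v1 vq qpz.
  have [u] : exists u, meval u q != 0 by apply: mpoly_nonzero_point; case: qp.
  by rewrite (meval_eq (v2 := v)) ?vq ?eqxx // => -[].
apply: contrapT => Nqp.
have [b b1 bq] : exists2 b, forall j : 'I_n.+1, `|b j - 0| < 1 & meval b q != 0.
  apply: (mpoly_nonzero_in (S := fun _ x => `|x - 0| < 1)); last by case: qp.
  by move=> _; apply: infinite_ball.
pose mix m := fun j : 'I_n.+1 => if (j < m)%N then b j else v j.
have mix1 m j : `|mix m j| < 1.
  by rewrite /mix; case: ifP => // _; rewrite -[b j]subr0.
have mixq m : (m <= n.+1)%N -> meval (mix m) q = 0.
  elim: m => [_|m IHm mn]; first by rewrite -vq; apply: meval_eq.
  pose k : 'I_n.+1 := Ordinal mn; apply: contrapT => /eqP mq; apply: Nqp.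
  apply: (@slice_prime_zero n k q p (mix m) (b k) qp (mix1 m) _ _ qpz).
    exact: IHm (ltnW mn).
  rewrite (meval_eq (v2 := mix m.+1)) // => j; rewrite /subst_at /mix.
  have [->|jk] := eqVneq j k; first by rewrite /= ltnS leqnn.
  have jm : (j == m :> nat) = false.
    by apply: contra_neqF jk => /eqP jm; apply: val_inj.
  by rewrite ltnS [(j <= m)%N]leq_eqVlt jm.
move/eqP: bq; apply; rewrite -(mixq n.+1) //; apply: meval_eq => j.
by rewrite /mix ltn_ord.
Qed.

End ZeroSet.

(** * Null sets of the torus *)

Section NullSets.
Variable R : realType.
Local Notation C := R[i].

(** One step of Fubini's theorem.  If every t in [0, pi[ outside the finite
set s gave a sum larger than e, integrating over this set, of measure pi > 1,
would contradict the bound on the sum of the c k (b k - a k). *)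
Lemma coordinate_choice (c a b : nat -> R) (e : R) (s : seq R) : 0 < e ->
  (forall k, 0 <= c k) -> (forall k, a k <= b k) ->
  (\sum_(0 <= k <oo) (c k * (b k - a k))%:E <= e%:E)%E ->
  exists t, [/\ 0 <= t < pi, t \notin s &
    (\sum_(0 <= k <oo) (c k * (a k < t < b k)%R%:R)%:E <= e%:E)%E].
Proof.
move=> e0 c0 ab sum_le; apply: contrapT => nex.
pose mu := @lebesgue_measure R.
pose g k (t : measurableTypeR R) := (c k * (a k < t < b k)%R%:R)%:E.
pose D := (`[0, pi[ `\` [set` s])%classic.
have sC : countable [set` s] by apply: finite_set_countable; exact: finite_seq.
have sM : measurable [set` s] by apply: countable_measurable.
have DM : measurable D by apply: measurableD => //; exact: measurable_itv.
have gE k : g k = fun t => ((c k)%:E * (\1_(`]a k, b k[%classic) t)%:E)%E.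
  by apply/funext => t; rewrite /g EFinM indicE mem_setE /= in_itv.
have gM k (A : set (measurableTypeR R)) : measurable_fun A (g k).
  rewrite gE; apply: measurable_funTS; apply: measurable_funeM.
  by apply/measurable_EFinP; exact: measurable_indic.
have g0 k t : (0 <= g k t)%E by rewrite lee_fin mulr_ge0.
have big t : D t -> (e%:E <= \sum_(0 <= k <oo) g k t)%E.
  move=> [/= tI ts]; rewrite leNgt; apply/negP => lt; apply: nex; exists t.
  split; [by move: tI; rewrite in_itv|exact/negP|exact: ltW].
have pi1 : 1 < pi :> R by have := pi_ge2 R; lra.
have muD : (pi%:E <= mu D)%E.
  have -> : (mu D = mu (D `|` [set` s])%classic)%E.
    by apply/esym/measureU0 => //; apply: countable_lebesgue_measure0; exact: sC.
  have <- : mu `[0, pi[%classic = pi%:E.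
    by rewrite /mu lebesgue_measure_itv /= lte_fin (lt_trans ltr01) // -EFinB subr0.
  apply: le_measure; rewrite ?inE; [exact: measurable_itv|exact: measurableU|].
  by move=> t tI; have [ts|ts] := boolP (t \in s); [right|left; split => //; apply/negP].
have : (e%:E * pi%:E <= e%:E)%E.
  apply: le_trans sum_le; apply: (@le_trans _ _ (e%:E * mu D)%E).
    by apply: lee_wpmul2l => //; rewrite lee_fin ltW.
  rewrite -integral_cst //.
  apply: (@le_trans _ _ (\int[mu]_(t in D) \sum_(0 <= k <oo) g k t)%E).
    apply: ge0_le_integral => //.
    - by move=> t _; rewrite lee_fin ltW.
    - by apply: ge0_emeasurable_sum.
  rewrite integral_nneseries //.
  apply: lee_nneseries => [k _ _|k _]; first by apply: integral_ge0.
  apply: (@le_trans _ _ (\int[mu]_t g k t)%E).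
    by apply: ge0_subset_integral.
  under eq_integral do rewrite gE.
  rewrite ge0_integralZl_EFin //; last first.
    by apply/measurable_EFinP; exact: measurable_indic.
  rewrite integral_indic // setIT -[X in (_ * X)%E]/(lebesgue_measure `]a k, b k[%classic).
  rewrite lebesgue_measure_itv /= lte_fin -EFinB.
  case: ifP => _; first by rewrite -EFinM.
  by rewrite mule0 lee_fin mulr_ge0 ?subr_ge0.
by rewrite -EFinM lee_fin ger_pMr // leNgt pi1.
Qed.

(** The angles are chosen one after the other, keeping at most 1/2 the total volume
of those boxes of the cover that still meet the slice, and keeping T nonzero
somewhere on the slice.  With all angles chosen, a box containing t would
contribute 1.  Angles are taken in [0, pi[, where the cosine is injective, so that
the roots to be avoided correspond to finitely many angles. *)
Lemma null_avoid n (A : set 'rV[R]_n) (T : mpoly n C) :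
  lebesgue_null A -> T != 0 -> exists t : 'rV[R]_n,
    [/\ forall j, 0 <= t 0 j < 2 * pi, ~ A t & meval (torus_point t 0) T != 0].
Proof.
move=> Anull T0; have h0 : 0 < 2^-1 :> R by rewrite invr_gt0.
have [a [b [ab Acov vol]]] := Anull _ h0.
(* the factor of coordinate j in the volume of box k, once m angles are chosen *)
pose w m (t : 'I_n -> R) k (j : 'I_n) := if (j < m)%N
  then (a k 0 j < t j < b k 0 j)%R%:R else b k 0 j - a k 0 j.
have w0 m t k j : 0 <= w m t k j.
  by rewrite /w; case: ifP => _; [exact: ler0n|rewrite subr_ge0].
suff /(_ n (leqnn n)) [t [v [tI vt vT sum_le]]] : forall m, (m <= n)%N -> exists t v,
    [/\ forall j : 'I_n, (j < m)%N -> 0 <= t j < pi,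
        forall j : 'I_n, (j < m)%N -> v j = cos (t j) +i* sin (t j),
        meval v T != 0 &
        (\sum_(0 <= k <oo) (\prod_j w m t k j)%:E <= (2^-1)%:E)%E].
  exists (\row_j t j); split.
  - move=> j; rewrite mxE; have /andP[-> /=] := tI j (ltn_ord j).
    by move=> /lt_trans -> //; have := pi_ge2 R; lra.
  - move=> /Acov [k _ tk]; move: sum_le; apply/negP; rewrite -ltNge.
    apply: (@lt_le_trans _ _ (\prod_j w n t k j)%:E).
      rewrite big1 ?lte_fin; first by lra.
      by move=> j _; rewrite /w ltn_ord; have := tk j; rewrite mxE => ->.
    have pos i : (0 <= (\prod_j w n t i j)%:E)%E by rewrite lee_fin prodr_ge0.
    rewrite (nneseriesD1 (n := k)) // leeDl //.
    by apply: nneseries_ge0.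
  - rewrite (meval_eq (v2 := v)) // => j; rewrite !mxE vt //.
elim=> [_|m IHm mn].
  have [v vT] := mpoly_nonzero_point T0; exists (fun=> 0), v; split=> //.
have [t [v [tI vt vT sum_le]]] := IHm (ltnW mn); pose i := Ordinal mn.
have [s lE] := closed_field_poly_normal (line v i T).
have l0 := line_neq0 i vT.
pose c k := \prod_(j | j != i) w m t k j.
(* acos (Re z) is the only angle in [0, pi[ that can lead to the point z *)
have [|||x [xI xs x_le]] := @coordinate_choice c (fun k => a k 0 i) (fun k => b k 0 i)
  2^-1 (map (fun z => acos (complex.Re z)) s) h0.
- by move=> k; apply: prodr_ge0.
- by [].
- apply: le_trans sum_le; rewrite le_eqVlt; apply/orP; left; apply/eqP.
  apply: eq_eseriesr => k _; rewrite [in RHS](bigD1 i) //= /w ltnn mulrC.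
  by [].
pose xi : C := cos x +i* sin x.
exists (subst_at i x t), (subst_at i xi v); split.
- move=> j; rewrite /subst_at ltnS leq_eqVlt; have [-> //|jk] := eqVneq j i.
  by move=> /orP[/eqP jm|]; [case/eqP: jk; apply: val_inj|apply: tI].
- move=> j; rewrite /subst_at ltnS leq_eqVlt; have [-> //|jk] := eqVneq j i.
  by move=> /orP[/eqP jm|]; [case/eqP: jk; apply: val_inj|apply: vt].
- rewrite -horner_line lE hornerZ mulf_neq0 ?lead_coef_eq0 //.
  rewrite -[_ == 0]/(root _ xi) root_prod_XsubC; apply: contra xs => xs.
  apply/mapP; exists xi => //=; rewrite cosK //.
  by rewrite in_itv /=; case/andP: xI => -> /ltW.
- apply: le_trans x_le; rewrite le_eqVlt; apply/orP; left; apply/eqP.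
  apply: eq_eseriesr => k _; rewrite (bigD1 i) //= /w ltnSn /subst_at eqxx mulrC.
  congr ((_ * _)%:E); apply: eq_bigr => j ji; rewrite (negPf ji) ltnS.
  have jm : (j == m :> nat) = false.
    by apply: contra_neqF ji => /eqP jm; apply: val_inj.
  by rewrite [(j <= m)%N]leq_eqVlt jm.
Qed.

End NullSets.

(** * Reflection of polynomials *)

Section Monomials.
Variables (F : numClosedFieldType) (n : nat).
Implicit Types (p q : mpoly n F) (m N : multinom n) (j : 'I_n).

Lemma unit_mpolyC c : c != 0 -> mpolyC n c \is a @GRing.unit (mpoly n F).
Proof. by move=> c0; apply: (rmorph_unit (@mpolyC n F)); rewrite unitfE. Qed.

Lemma mpoly_unit_const p : p \is a GRing.unit -> exists2 c, c != 0 & p = mpolyC n c.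
Proof.
case/unitrP=> q [qp _]; have p0 : p != 0.
  by apply: contra_eq_neq qp => ->; rewrite mulr0 eq_sym oner_neq0.
have q0 : q != 0.
  by apply: contra_eq_neq qp => ->; rewrite mul0r eq_sym oner_neq0.
apply/msize_poly1P; have := congr1 (fun r : mpoly n F => msize r) qp.
rewrite msizeM // msize1 (mpolySpred _ p0) (mpolySpred _ q0) addSn addnS /=.
by case=> /eqP; rewrite addn_eq0 => /andP[_ /eqP->].
Qed.

Lemma msize_unit p : p != 0 -> (msize p <= 1)%N -> p \is a GRing.unit.
Proof.
move=> p0 /msize1_polyC pE; rewrite pE; apply: unit_mpolyC.
by apply: contra_neq p0 => c0; rewrite pE c0 mpolyC0.
Qed.

Lemma prime_elt_mpolyX j : prime_elt (mpolyX F (mnm1 j)).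
Proof.
have szX : msize (mpolyX F (mnm1 j)) = 2%N by rewrite msizeX mdeg1.
have X0 : mpolyX F (mnm1 j) != 0 by rewrite -msize_poly_eq0 szX.
apply: irreducible_prime_elt => //; first exact: factorial_mpoly.
  by apply/negP => /mpoly_unit_const [c c0 E]; move: szX; rewrite E msizeC c0.
move=> a b E; have [a0 b0] : a != 0 /\ b != 0.
  by move: X0; rewrite E mulf_eq0 negb_or => /andP[].
move: szX; rewrite E msizeM // => sz.
have [a1|a1] := leqP (msize a) 1; first by left; apply: msize_unit.
right; apply: msize_unit => //; move: sz a1.
by case: (msize a) => [|[|k]]; case: (msize b) => [|[|l]] //=; lia.
Qed.

Lemma divides_mpolyX j p m :
  divides (mpolyX F (mnm1 j)) p -> m \in msupp p -> (0 < m j)%N.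
Proof.
case=> q ->; rewrite (perm_mem (msuppMX _ _)) => /mapP [m' _ ->].
by rewrite mnmDE mnm1E eqxx.
Qed.

Lemma multinom_neq0 m : m != mnm0 -> exists j m', m = mnm_add (mnm1 j) m'.
Proof.
move=> m0; have [j mj] : exists j, (0 < m j)%N.
  apply: contrapT => nex; case/eqP: m0; apply/mnmP => j; rewrite mnm0E.
  by apply/eqP; rewrite -leqn0 leqNgt; apply/negP => mj; apply: nex; exists j.
exists j, (mnm_sub m (mnm1 j)); rewrite addmC submK //.
by apply/mnm_lepP => i; rewrite mnm1E; case: eqP => // <-.
Qed.

Lemma divisor_monomial p q m : p * q = mpolyX F m ->
  exists c k, p = c *: mpolyX F k.
Proof.
have [d] := ubnP (mdeg m); elim: d m p q => // d IHd m p q md pq.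
have [m0|/multinom_neq0 [j [m' mE]]] := eqVneq m mnm0.
  have [c _ ->] : exists2 c, c != 0 & p = mpolyC n c.
    apply: mpoly_unit_const; apply/unitrP; exists q.
    by rewrite pq [q * p]mulrC pq m0 mpolyX0.
  by exists c, mnm0; rewrite mpolyX0 -mul_mpolyC mulr1.
have [X0 _ XP] := prime_elt_mpolyX j.
have md' : (mdeg m' < d)%N by move: md; rewrite mE mdegD mdeg1.
have [[r E]|[r E]] : divides (mpolyX F (mnm1 j)) p \/ divides (mpolyX F (mnm1 j)) q.
  by apply: XP; rewrite pq mE mpolyXD; exists (mpolyX F m'); rewrite mulrC.
- have [|c [k rE]] := IHd m' r q md'.
    by apply: (mulfI X0); rewrite -mpolyXD -mE -pq E; ring.
  by exists c, (mnm_add k (mnm1 j)); rewrite E rE mpolyXD scalerAl.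
- apply: (IHd m' p r md').
  by apply: (mulfI X0); rewrite -mpolyXD -mE -pq E; ring.
Qed.

Lemma mpoly_ext_nonzero p q :
  (forall v, (forall j, v j != 0) -> meval v p = meval v q) -> p = q.
Proof.
move=> pq; apply/eqP; rewrite -subr_eq0; apply: contrapT => /negP d0.
have [v v1 /negP] := mpoly_nonzero_in (fun _ : 'I_n => infinite_ball 1 ltr01) d0.
apply; rewrite mevalB pq ?subrr // => j; apply: contraTneq (v1 j) => ->.
by rewrite sub0r normrN normr1 ltxx.
Qed.

End Monomials.

Section Reflection.
Variables (R : realType) (n : nat).
Local Notation C := R[i].
Implicit Types (A B Q : mpoly n C) (N M m : multinom n) (v w : 'I_n -> C).

Definition degree_le N Q : Prop :=
  forall m, m \in msupp Q -> forall j, (m j <= N j)%N.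

(** The polynomial z^N conj(Q)(1/z).  A free exponent N, rather than nu Q, makes
the operation multiplicative and involutive. *)
Definition reflect_at N Q : mpoly n C :=
  \sum_(m <- msupp Q) (mcoeff m (tilde Q)) *: mpolyX C (mnm_sub N m).

Lemma degree_le_nu Q : degree_le (nu Q) Q.
Proof. by move=> m mQ j; apply: le_nu. Qed.

Lemma meval_reflect N Q v : degree_le N Q -> (forall j, v j != 0) ->
  meval v (reflect_at N Q) =
  (\prod_j v j ^+ N j) * conjc (meval (fun j => (conjc (v j))^-1) Q).
Proof.
move=> QN v0; rewrite /reflect_at raddf_sum /= mevalE rmorph_sum /= mulr_sumr.
rewrite big_seq [RHS]big_seq; apply: eq_bigr => m mQ.
rewrite mevalZ mevalX rmorphM mcoeff_map_mpoly mulrCA /= rmorph_prod /=.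
congr (_ * _); rewrite -big_split /=; apply: eq_bigr => j _.
rewrite mnmBE rmorphXn /= fmorphV /= conjcK exprVn expfB_cond ?QN //.
by rewrite (negPf (v0 j)) add0n QN.
Qed.

Lemma conjc_torus (x : C) : `|x| = 1 -> (conjc x)^-1 = x.
Proof.
move=> x1; rewrite invc_norm normcJ x1 expr1n invr1 mul1r.
exact: conjcK.
Qed.

Lemma torus_neq0 (x : C) : `|x| = 1 -> x != 0.
Proof. by move=> x1; rewrite -normr_eq0 x1 oner_neq0. Qed.

Lemma meval_reflect_torus N Q w : degree_le N Q -> (forall j, `|w j| = 1) ->
  meval w (reflect_at N Q) = (\prod_j w j ^+ N j) * conjc (meval w Q).
Proof.
move=> QN w1; rewrite (meval_reflect QN) => [|j]; last exact: torus_neq0.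
by congr (_ * conjc _); apply: meval_eq => j; rewrite conjc_torus.
Qed.

Lemma norm_reflect_torus N Q w : degree_le N Q -> (forall j, `|w j| = 1) ->
  `|meval w (reflect_at N Q)| = `|meval w Q|.
Proof.
move=> QN w1; rewrite meval_reflect_torus // normrM normcJ normr_prod.
by rewrite big1 ?mul1r // => j _; rewrite normrX w1 expr1n.
Qed.

Lemma mcoeff_reflect N Q m : degree_le N Q -> (forall j, (m j <= N j)%N) ->
  mcoeff m (reflect_at N Q) = conjc (mcoeff (mnm_sub N m) Q).
Proof.
move=> QN mN; rewrite /reflect_at raddf_sum /=.
have E k : k \in msupp Q -> (mnm_sub N k == m) = (k == mnm_sub N m).
  move=> kQ; apply/eqP/eqP => [<-|->]; apply/mnmP => j; rewrite !mnmBE subKn //.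
  exact: QN.
under eq_big_seq => k kQ do rewrite mcoeffZ mcoeffX mcoeff_map_mpoly E //.
have [NmQ|NmQ] := boolP (mnm_sub N m \in msupp Q).
  rewrite (bigD1_seq (mnm_sub N m)) ?msupp_uniq //= eqxx mulr1 big1 ?addr0 //.
  by move=> k /negPf->; rewrite mulr0.
rewrite (memN_msupp_eq0 NmQ) conjc0 big_seq big1 // => k kQ.
by rewrite (_ : _ == _ = false) ?mulr0 //; apply: contraNF NmQ => /eqP <-.
Qed.

Lemma degree_le_reflect N Q : degree_le N (reflect_at N Q).
Proof.
move=> m mR j; have := msupp_sum_le mR; rewrite filter_predT => /flattenP [s].
move=> /mapP [k kQ ->] /msuppZ_le; rewrite msuppX inE => /eqP ->.
by rewrite mnmBE leq_subr.
Qed.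

Lemma degree_leM N M A B : degree_le N A -> degree_le M B ->
  degree_le (mnm_add N M) (A * B).
Proof.
move=> AN BM m /msuppM_le /allpairsP [[a b] /= [aA bB ->]] j.
by rewrite !mnmDE leq_add ?AN ?BM.
Qed.

Lemma reflectM N M A B : degree_le N A -> degree_le M B ->
  reflect_at (mnm_add N M) (A * B) = reflect_at N A * reflect_at M B.
Proof.
move=> AN BM; apply: mpoly_ext_nonzero => v v0.
rewrite mevalM !meval_reflect //; last exact: degree_leM.
rewrite mevalM rmorphM mulrACA -big_split /=; congr (_ * _).
by apply: eq_bigr => j _; rewrite mnmDE exprD.
Qed.

Lemma reflect_add N M Q : degree_le N Q ->
  reflect_at (mnm_add M N) Q = mpolyX C M * reflect_at N Q.
Proof.
move=> QN; have QMN : degree_le (mnm_add M N) Q.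
  by move=> m mQ j; rewrite mnmDE (leq_trans (QN m mQ j)) // leq_addl.
apply: mpoly_ext_nonzero => v v0; rewrite mevalM mevalX !meval_reflect // mulrA.
rewrite -big_split /=; congr (_ * _); apply: eq_bigr => j _.
by rewrite mnmDE exprD.
Qed.

Lemma reflectK N Q : degree_le N Q -> reflect_at N (reflect_at N Q) = Q.
Proof.
move=> QN; apply/mpolyP => m; have [mN|mN] := boolP [forall j, (m j <= N j)%N].
  move/forallP in mN; rewrite mcoeff_reflect //; last exact: degree_le_reflect.
  have subN j : (mnm_sub N m j <= N j)%N by rewrite mnmBE leq_subr.
  rewrite mcoeff_reflect // conjcK; congr (mcoeff _ Q); apply/mnmP => j.
  by rewrite !mnmBE subKn.
have out P : degree_le N P -> mcoeff m P = 0.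
  move=> PN; apply: memN_msupp_eq0; apply: contra mN => mP; apply/forallP.
  exact: PN.
by rewrite !out //; apply: degree_le_reflect.
Qed.

Lemma nu_attained Q j : Q != 0 -> exists2 m, m \in msupp Q & m j = nu Q j.
Proof.
move=> Q0; have := mlead_supp Q0; move: (mlead Q) => m0 m0Q.
rewrite /nu mnmE /=.
have [m mQ ->] : exists2 m, m \in msupp Q & \max_(k <- msupp Q) (k j : nat) = m j.
  elim: (msupp Q) m0 m0Q => [//|k s IHs] m0 _; rewrite big_cons.
  case: s IHs => [|l s] IHs; first by exists k; rewrite ?mem_head // big_nil maxn0.
  have [m ms ->] := IHs l (mem_head _ _).
  by case: (leqP (m j) (k j)) => le; [exists k|exists m]; rewrite ?mem_head // inE ms orbT.
by exists m.
Qed.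

(** A monomial of Q of maximal degree in z_j is reflected to one free of z_j. *)
Lemma Ndivides_mpolyX_reflection Q j : Q != 0 ->
  ~ divides (mpolyX C (mnm1 j)) (reflection Q).
Proof.
move=> Q0 /divides_mpolyX dX; have [m mQ mj] := nu_attained j Q0.
have := dX (mnm_sub (nu Q) m); rewrite mnmBE mj subnn => /(_ _)/negP; apply => //.
rewrite mcoeff_msupp mcoeff_reflect; [|exact: degree_le_nu|]; last first.
  by move=> i; rewrite mnmBE leq_subr.
rewrite (_ : mnm_sub _ _ = m); last first.
  by apply/mnmP => i; rewrite !mnmBE subKn // le_nu.
by rewrite conjc_eq0 -mcoeff_msupp.
Qed.

Lemma nu_min N Q j : Q != 0 -> degree_le N Q -> (nu Q j <= N j)%N.
Proof. by move=> Q0 QN; have [m mQ <-] := nu_attained j Q0; apply: QN. Qed.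

(** The nontrivial inequality: the excess K of nu A + nu B over nu (A B) would
make z^K divide the product of the reflections of A and B, neither of which is
divisible by a variable. *)
Lemma nuM A B : A != 0 -> B != 0 -> nu (A * B) = mnm_add (nu A) (nu B).
Proof.
move=> A0 B0; have AB0 : A * B != 0 by rewrite mulf_neq0.
have leN : degree_le (mnm_add (nu A) (nu B)) (A * B).
  by apply: degree_leM; apply: degree_le_nu.
pose K := mnm_sub (mnm_add (nu A) (nu B)) (nu (A * B)).
have KE : mnm_add K (nu (A * B)) = mnm_add (nu A) (nu B).
  by rewrite submK //; apply/mnm_lepP => j; apply: nu_min.
have [K0|/multinom_neq0 [j [K' K'E]]] := eqVneq K mnm0.
  by rewrite -KE K0 add0m.
have [_ _ XP] := prime_elt_mpolyX C j.
case: (XP (reflection A) (reflection B)).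
- rewrite -reflectM; [|exact: degree_le_nu|exact: degree_le_nu].
  rewrite -KE reflect_add; last exact: degree_le_nu.
  rewrite K'E mpolyXD -mulrA; apply/divides_mulr/divides_refl.
- by move=> /(Ndivides_mpolyX_reflection A0).
- by move=> /(Ndivides_mpolyX_reflection B0).
Qed.

Lemma reflectionM A B : A != 0 -> B != 0 ->
  reflection (A * B) = reflection A * reflection B.
Proof.
move=> A0 B0; rewrite -[LHS]/(reflect_at (nu (A * B)) _) nuM // reflectM //;
  exact: degree_le_nu.
Qed.

End Reflection.

(** * The bound of a zero-free polynomial over its reflection *)

Section TopCoefficient.
Variable F : numClosedFieldType.
Implicit Types (p q : {poly F}).

(** Only a bound on the degree: as c may vanish, products and sums need no case
distinction. *)
Definition has_top (d : nat) (c : F) p : Prop := (size p <= d.+1)%N /\ p`_d = c.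

Lemma has_topM d e a b p q :
  has_top d a p -> has_top e b q -> has_top (d + e) (a * b) (p * q).
Proof.
move=> [szp <-] [szq <-]; split.
  by apply: leq_trans (size_polyMleq _ _) _; move: szp szq; lia.
rewrite coefM; have dlt : (d < (d + e).+1)%N by rewrite ltnS leq_addr.
rewrite (bigD1 (Ordinal dlt)) //= addKn big1 ?addr0 // => i id.
have [di|di] := ltnP d i.
  by rewrite (nth_default 0 (leq_trans szp di)) mul0r.
rewrite [q`_ _]nth_default ?mulr0 //; apply: leq_trans szq _.
have : (i : nat) != d by apply: contraNneq id => id; apply/eqP/val_inj.
by move: di; lia.
Qed.

Lemma has_top1 : has_top 0 1 (1 : {poly F}).
Proof. by split; rewrite ?size_poly1 // coef1. Qed.

Lemma has_topX d c p k : has_top d c p -> has_top (d * k) (c ^+ k) (p ^+ k).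
Proof.
move=> tp; elim: k => [|k IHk]; first by rewrite muln0 !expr0; apply: has_top1.
by rewrite mulnS !exprS; apply: has_topM.
Qed.

Lemma has_top_prod (I : finType) (d : I -> nat) (c : I -> F) (p : I -> {poly F}) :
  (forall i, has_top (d i) (c i) (p i)) ->
  has_top (\sum_i d i) (\prod_i c i) (\prod_i p i).
Proof.
move=> tp; elim/big_rec3: _ => [|i q b e _ tq]; first exact: has_top1.
exact: has_topM.
Qed.

Lemma has_top_sum (I : eqType) (r : seq I) d (c a : I -> F) (p : I -> {poly F}) :
  (forall i, i \in r -> has_top d (c i) (p i)) ->
  has_top d (\sum_(i <- r) a i * c i) (\sum_(i <- r) a i *: p i).
Proof.
elim: r => [|i r IHr] tp; first by rewrite !big_nil; split; rewrite ?size_poly0 ?coef0.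
rewrite !big_cons; have [szi iE] := tp i (mem_head _ _).
have [|szr rE] := IHr; first by move=> j jr; apply: tp; rewrite inE jr orbT.
split; last by rewrite coefD coefZ iE rE.
apply: leq_trans (size_polyD _ _) _; rewrite geq_max szr andbT.
exact: leq_trans (size_scale_leq _ _) szi.
Qed.

(** Up to sign the quotient of the constant term by the leading coefficient is
the product of the roots, all of modulus at least 1. *)
Lemma top_coef_le d p : (size p <= d.+1)%N ->
  (forall x, `|x| < 1 -> p.[x] != 0) -> `|p`_d| <= `|p`_0|.
Proof.
move=> szp pnz; have [->|pd] := eqVneq p`_d 0; first by rewrite normr0.
have szE : size p = d.+1.
  by apply/eqP; rewrite eqn_leq szp ltnNge; apply: contra pd => /leq_sizeP ->.
have lE : lead_coef p = p`_d by rewrite lead_coefE szE.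
have [s pE] := closed_field_poly_normal p.
have -> : p`_0 = p`_d * \prod_(x <- s) - x.
  rewrite -horner_coef0 {1}pE hornerZ lE horner_prod; congr (_ * _).
  by apply: eq_bigr => x _; rewrite hornerXsubC sub0r.
rewrite normrM ler_peMr // normr_prod.
have s1 x : x \in s -> 1 <= `|x|.
  move=> xs; case: real_leP => //; rewrite ?normr_real ?real1 // => /pnz.
  by rewrite pE hornerZ mulf_eq0 negb_or -[X in _ && ~~ X]/(root _ x) root_prod_XsubC xs andbF.
rewrite big_seq; elim/big_rec: _ => // x y xs y1.
by rewrite normrN mulr_ege1 // s1.
Qed.

End TopCoefficient.

Section SchurBound.
Variables (R : realType) (n : nat).
Local Notation C := R[i].
Implicit Types (A : mpoly n C) (v w : 'I_n -> C).

Lemma moebius_lt1 (x v : C) : `|x| < 1 -> `|v| < 1 ->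
  1 + conjc v * x != 0 /\ `|(x + v) / (1 + conjc v * x)| < 1.
Proof.
move=> x1 v1; have lt : `|x + v| < `|1 + conjc v * x|.
  rewrite -(ltr_pXn2r (n := 2)) // ?nnegrE // !sqr_normc.
  have -> : conjc (1 + conjc v * x) = 1 + v * conjc x.
    by rewrite rmorphD rmorphM rmorph1; congr (1 + _ * _); apply: conjcK.
  rewrite (rmorphD (@conjc R) x v).
  rewrite -subr_gt0.
  have -> : (1 + conjc v * x) * (1 + v * conjc x) - (x + v) * (conjc x + conjc v) =
    (1 - `|x| ^+ 2) * (1 - `|v| ^+ 2) by rewrite !sqr_normc; ring.
  by rewrite mulr_gt0 // subr_gt0 expr_lt1.
have d0 : 1 + conjc v * x != 0 by rewrite -normr_gt0 (le_lt_trans _ lt).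
by split => //; rewrite normrM normfV ltr_pdivrMr ?normr_gt0 // mul1r.
Qed.

(** The numerator of A composed with the Moebius maps x |-> (x + v_j) / (1 + conj(v_j) x),
which send 0 to v_j and the disc to itself. *)
Definition moebius_poly A v : {poly C} :=
  \sum_(m <- msupp A) mcoeff m A *:
    \prod_j (('X + (v j)%:P) ^+ m j * (1 + conjc (v j) *: 'X) ^+ (nu A j - m j)).

Lemma horner_moebius A v x : (forall j, 1 + conjc (v j) * x != 0) ->
  (moebius_poly A v).[x] = \prod_j (1 + conjc (v j) * x) ^+ nu A j *
    meval (fun j => (x + v j) / (1 + conjc (v j) * x)) A.
Proof.
move=> d0; rewrite /moebius_poly horner_sum mevalE mulr_sumr.
rewrite big_seq [RHS]big_seq; apply: eq_bigr => m mA.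
rewrite hornerZ mulrCA horner_prod -big_split /=; congr (_ * _).
apply: eq_bigr => j _; rewrite !hornerE /= expr_div_n mulrCA; congr (_ * _).
by rewrite expfB_cond ?(negPf (d0 j)) ?add0n ?le_nu.
Qed.

(** At infinity the Moebius maps take the values 1 / conj(v_j), so the top
coefficient is the conjugate of the reflection of A at v. *)
Lemma has_top_moebius A v :
  has_top (\sum_j nu A j) (conjc (meval v (reflection A))) (moebius_poly A v).
Proof.
have termE m :
    conjc (meval v (mcoeff m (tilde A) *: mpolyX C (mnm_sub (nu A) m))) =
    mcoeff m A * \prod_j (1 ^+ m j * conjc (v j) ^+ (nu A j - m j)).
  rewrite mevalZ mevalX mcoeff_map_mpoly rmorphM rmorph_prod.
  congr (_ * _); first exact: conjcK.
  by apply: eq_bigr => j _; rewrite expr1n mul1r mnmBE; apply: rmorphXn.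
have -> : conjc (meval v (reflection A)) =
    \sum_(m <- msupp A) mcoeff m A *
      \prod_j (1 ^+ m j * conjc (v j) ^+ (nu A j - m j)).
  rewrite /reflection (raddf_sum (meval v)) (rmorph_sum (@conjc R)).
  by apply: eq_bigr => m _; apply: termE.
apply: has_top_sum => m mA.
rewrite (eq_bigr (fun j => 1 * m j + 1 * (nu A j - m j))%N) => [|j _]; last first.
  by rewrite !mul1n subnKC // le_nu.
apply: has_top_prod => j; apply: has_topM; apply: has_topX.
  by split; rewrite ?size_XaddC // coefD coefX coefC addr0.
split; last by rewrite coefD coef1 coefZ coefX mulr1 add0r.
apply: leq_trans (size_polyD _ _) _; rewrite geq_max size_poly1 /=.
by apply: leq_trans (size_scale_leq _ _) _; rewrite size_polyX.
Qed.

(** The constant and top coefficients of the Moebius polynomial at v are A(v) and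
the conjugate of A^(v). *)
Lemma norm_reflection_le A v :
  (forall w, (forall j, `|w j| < 1) -> meval w A != 0) ->
  (forall j, `|v j| < 1) -> `|meval v (reflection A)| <= `|meval v A|.
Proof.
move=> Anz v1; have [sz topE] := has_top_moebius A v.
have -> : meval v A = (moebius_poly A v)`_0.
  rewrite -horner_coef0 horner_moebius => [|j]; last by rewrite mulr0 addr0 oner_neq0.
  rewrite big1 ?mul1r => [|j _]; last by rewrite mulr0 addr0 expr1n.
  by apply: meval_eq => j; rewrite add0r mulr0 addr0 divr1.
rewrite -normcJ -topE; apply: top_coef_le => // x x1.
have mob j := moebius_lt1 x1 (v1 j).
rewrite horner_moebius => [|j]; last by case: (mob j).
rewrite mulf_neq0 // ?Anz // => [|j]; last by case: (mob j).
by apply/prodf_neq0 => j _; rewrite expf_neq0 //; case: (mob j).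
Qed.

(** The restriction of a polynomial to the complex line through 0 and w. *)
Definition radial w : mpoly n C -> {poly C} := mmap polyC (fun j => w j *: 'X).
HB.instance Definition _ w := GRing.RMorphism.on (radial w).

Lemma horner_radial w A x : (radial w A).[x] = meval (fun j => w j * x) A.
Proof.
apply: (mpoly_morph_ext (f := horner_eval x \o radial w)
  (g := meval (fun j => w j * x))) => [c|j] /=.
  by rewrite /radial mmapC /horner_eval hornerC mevalC.
by rewrite /radial mmapX mmap1U mevalXU /horner_eval hornerZ hornerX.
Qed.

End SchurBound.

(** * Zero-free reflections *)

Section TorusDensity.
Variables (R : realType) (n : nat).
Local Notation C := R[i].

(** For n = 0 each box has volume 1, and no set is null. *)
Lemma lebesgue_null0 : (0 < n)%N -> lebesgue_null (set0 : set 'rV[R]_n).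
Proof.
move=> n0 e e0; exists (fun=> 0), (fun=> 0); split => //.
rewrite eseries0 ?lee_fin ?ltW // => k _ _.
by rewrite (bigD1 (Ordinal n0)) //= subrr mul0r.
Qed.

Lemma norm_torus_point (t : 'rV[R]_n) j : `|torus_point t 0 j| = 1.
Proof. by rewrite mxE normc_def /= cos2Dsin2 sqrtr1. Qed.

Lemma torus_nonzero (T : mpoly n C) : (0 < n)%N -> T != 0 ->
  exists2 w : 'I_n -> C, forall j, `|w j| = 1 & meval w T != 0.
Proof.
move=> n0 T0; have [t [_ _ tT]] := null_avoid (lebesgue_null0 n0) T0.
by exists (torus_point t 0) => // j; apply: norm_torus_point.
Qed.

Lemma mpoly_ext_torus (A B : mpoly n C) : (0 < n)%N ->
  (forall w, (forall j, `|w j| = 1) -> meval w A = meval w B) -> A = B.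
Proof.
move=> n0 AB; apply/eqP; rewrite -subr_eq0; apply: contrapT => /negP d0.
have [w w1] := torus_nonzero n0 d0.
by rewrite mevalB AB // subrr eqxx.
Qed.

End TorusDensity.

Section UnitReflection.
Variables (R : realType) (n : nat).
Local Notation C := R[i].
Implicit Types (A : mpoly n C) (v w : 'I_n -> C).

Definition zero_free A : Prop :=
  forall v, (forall j, `|v j| < 1) -> meval v A != 0.

Lemma zero_free0 A : zero_free A -> meval (fun=> 0) A != 0.
Proof. by apply=> j; rewrite normr0 ltr01. Qed.

Lemma zero_free_neq0 A : zero_free A -> A != 0.
Proof. by move/zero_free0; apply: contra_neq => ->; rewrite meval0. Qed.

Lemma meval_radial_reflection A w x : (forall j, `|w j| = 1) -> x != 0 ->
  meval (fun j => w j * x) (reflection A) =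
  (\prod_j w j ^+ nu A j) * x ^+ (\sum_j nu A j) *
    conjc (radial w A).[(conjc x)^-1].
Proof.
move=> w1 x0; rewrite /reflection -/(reflect_at _ _) (meval_reflect (@degree_le_nu _ _ A)).
  congr (_ * conjc _).
    rewrite -prodrXr -big_split /=; apply: eq_bigr => j _; exact: exprMn.
  rewrite horner_radial; apply: meval_eq => j.
  by rewrite (rmorphM (@conjc R)) invfM conjc_torus.
by move=> j; rewrite mulf_neq0 // torus_neq0.
Qed.

Lemma poly_ext_nonzero (p q : {poly C}) :
  (forall x, x != 0 -> p.[x] = q.[x]) -> p = q.
Proof.
move=> pq; apply/eqP; rewrite -subr_eq0; apply: contrapT => /negP d0.
have [x x1] := infinite_nonroot (infinite_ball 1 ltr01) d0.
rewrite hornerD hornerN pq ?subrr ?eqxx //; apply: contraTneq x1 => ->.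
by rewrite sub0r normrN normr1 ltxx.
Qed.

(** Evaluation at 0 forces the powers of X to agree, and identifies k. *)
Lemma proportional_at0 (p q : {poly C}) k d e : p.[0] != 0 -> q.[0] != 0 ->
  'X^d * p = k *: ('X^e * q) -> forall x, p.[x] * q.[0] = p.[0] * q.[x].
Proof.
wlog de : p q k d e / (d <= e)%N.
  move=> wl p0 q0 E x; have [|/ltnW ed] := leqP d e; first by move=> de; exact: (wl _ _ _ _ _ de p0 q0 E).
  have k0 : k != 0.
    apply: contra_neq p0 => k0; move: E; rewrite k0 scale0r => /eqP.
    by rewrite mulf_eq0 expf_eq0 polyX_eq0 andbF => /eqP ->; rewrite horner0.
  rewrite [LHS]mulrC [RHS]mulrC; symmetry; apply: (wl q p k^-1 e d) => //.
  by rewrite E scalerA mulVf // scale1r.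
move=> p0 q0 E; have {}E : p = k *: ('X^(e - d) * q).
  have Xd0 : 'X^d != 0 :> {poly C} by rewrite expf_neq0 // polyX_eq0.
  by apply: (mulfI Xd0); rewrite E -scalerAr mulrA -exprD subnKC.
have ed : (e - d = 0)%N.
  apply/eqP; apply: contraNT p0 => ed; rewrite E hornerZ hornerM hornerXn.
  by rewrite expr0n (negPf ed) mul0r mulr0.
by move=> x; rewrite E ed mul1r !hornerZ; ring.
Qed.

(** Let a be the restriction of A to the line through w.  A root r of a has
|r| >= 1 since A is zero-free, and |r| <= 1 since 1 / conj(r) is a root of the
restriction of the reflection.  When all roots are on the circle, reversing and
conjugating a only multiplies it by a constant and a power of X. *)
Lemma reflection_proportional A w : zero_free A -> zero_free (reflection A) ->
  (forall j, `|w j| = 1) ->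
  meval w (reflection A) * meval (fun=> 0) A =
  meval (fun=> 0) (reflection A) * meval w A.
Proof.
move=> Anz Rnz w1; pose a := radial w A; pose b := radial w (reflection A).
have a0E B : (radial w B).[0] = meval (fun=> 0) B.
  by rewrite horner_radial; apply: meval_eq => j; rewrite mulr0.
have a1E B : (radial w B).[1] = meval w B.
  by rewrite horner_radial; apply: meval_eq => j; rewrite mulr1.
have in_disc x : `|x| < 1 -> forall j, `|w j * x| < 1.
  by move=> x1 j; rewrite normrM w1 mul1r.
have zero0 := zero_free0.
rewrite -!a0E -!a1E -/a -/b; have [s aE] := closed_field_poly_normal a.
have aN0 : a != 0.
  by apply: contra_neq (zero0 _ Anz) => a0; rewrite -a0E -/a a0 horner0.
have s1 r : r \in s -> `|r| = 1.
  move=> rs; have ra : a.[r] = 0.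
    by apply/rootP; rewrite aE rootZ ?lead_coef_eq0 // root_prod_XsubC.
  have r0 : r != 0.
    by apply: contra_neq (zero0 _ Anz) => r0; rewrite -a0E -/a -[RHS]ra r0.
  apply/eqP; rewrite eq_le; apply/andP; split.
    case: real_leP => //; rewrite ?normr_real ?real1 // => r1.
    have x0 : (conjc r)^-1 != 0 by rewrite invr_eq0 fmorph_eq0.
    have x1 : `|(conjc r)^-1| < 1 by rewrite normfV normcJ invf_lt1 // normr_gt0.
    have /eqP[] := Rnz _ (in_disc _ x1).
    rewrite meval_radial_reflection // (fmorphV (@conjc R)) invrK /= conjcK.
    by rewrite -/a ra (rmorph0 (@conjc R)) mulr0.
  case: real_leP => //; rewrite ?normr_real ?real1 // => r1.
  have /eqP[] := Anz _ (in_disc _ r1).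
  by rewrite -horner_radial.
pose k := (\prod_j w j ^+ nu A j) * conjc (lead_coef a) * \prod_(r <- s) (- conjc r).
have ka x : x != 0 -> x ^+ size s * conjc (a.[(conjc x)^-1]) =
    conjc (lead_coef a) * \prod_(r <- s) (- conjc r) * \prod_(r <- s) (x - r).
  move=> x0; rewrite {1}aE hornerZ horner_prod rmorphM rmorph_prod /=.
  rewrite mulrCA -[in RHS]mulrA; congr (_ * _).
  elim: s {aE k} s1 => [|r s IHs] s1; first by rewrite !big_nil !mulr1.
  rewrite !big_cons exprS -mulrA [_ ^+ _ * _]mulrCA mulrA IHs; last first.
    by move=> u us; apply: s1; rewrite inE us orbT.
  rewrite hornerXsubC (rmorphB (@conjc R)) (fmorphV (@conjc R)) /= conjcK.
  have r1 : r * conjc r = 1 by rewrite -sqr_normc s1 ?mem_head // expr1n.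
  have -> : x * (x^-1 - conjc r) = - conjc r * (x - r).
    by rewrite mulrBr mulfV // -r1; ring.
  by ring.
have abE : 'X^(size s) * b = (k / lead_coef a) *: ('X^(\sum_j nu A j) * a).
  apply: poly_ext_nonzero => x x0.
  have la : lead_coef a != 0 by rewrite lead_coef_eq0.
  rewrite hornerM hornerXn horner_radial meval_radial_reflection // mulrCA ka //.
  rewrite hornerZ hornerM hornerXn {3}aE hornerZ horner_prod /k.
  rewrite (eq_bigr (fun r => x - r) (F1 := fun r => ('X - r%:P).[x])); last first.
    by move=> r _; rewrite hornerXsubC.
  have cancel_lead (W X c P Q l : C) : l != 0 ->
      W * X * (c * P * Q) = W * c * P / l * (X * (l * Q)).
    by move=> l0; field.
  exact: cancel_lead.
apply: (proportional_at0 _ _ abE); rewrite a0E; exact: zero0.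
Qed.

(** The ratio on each line through the torus is the ratio at 0, the same for all
lines, and a polynomial is determined by its values on the torus. *)
Lemma reflection_unit A : (0 < n)%N -> zero_free A -> zero_free (reflection A) ->
  exists2 k : C, `|k| = 1 & reflection A = k *: A.
Proof.
move=> n0 Anz Rnz; pose k := meval (fun=> 0) (reflection A) / meval (fun=> 0) A.
have z0 := zero_free0 Anz.
have E : reflection A = k *: A.
  apply: mpoly_ext_torus => // w w1; rewrite mevalZ /k mulrAC.
  by rewrite -reflection_proportional // mulfK.
exists k => //; have [w w1 wA] := torus_nonzero n0 (zero_free_neq0 Anz).
have := norm_reflect_torus (@degree_le_nu _ _ A) w1.
rewrite -[reflect_at _ _]/(reflection A) E mevalZ normrM => /eqP.
by rewrite -subr_eq0 -{2}[`|meval w A|]mul1r -mulrBl mulf_eq0 normr_eq0 (negPf wA) orbF subr_eq0 => /eqP.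
Qed.

End UnitReflection.

(** * Quotients of a reflection by the polynomial *)

Section PolyContinuity.
Variable K : numFieldType.

Lemma continuous_horner_num (p : {poly K}) : continuous (horner p : K -> K).
Proof.
elim/poly_ind: p => [|p c IHp] x.
  rewrite (_ : (horner 0 : K -> K) = cst 0); first exact: cst_continuous.
  by apply/funext => y; rewrite horner0.
rewrite (_ : (horner _ : K -> K) = (fun y => p.[y] * y + c)); last first.
  by apply/funext => y; rewrite hornerMXaddC.
apply: (@continuousD _ K^o _ (fun y : K => p.[y] * y) (fun=> c) x).
  by apply: (@continuousM _ _ (horner p) (fun y : K => y) x); [exact: IHp|move=> B].
exact: cst_continuous.
Qed.

Lemma quotient_limit (b : {poly K}) i k : b.[1] != 0 ->
  (x ^+ i * x^-1 ^+ k * `|b.[x^-1]| / `|b.[x]| @[x --> (1 : K)] --> (1 : K))%classic.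
Proof.
move=> b1; pose h (x : K) := x ^+ i * x^-1 ^+ k * `|b.[x^-1]| / `|b.[x]|.
have h1 : h 1 = 1 by rewrite /h invr1 !expr1n !mul1r divff // normr_eq0.
have inv1 : {for (1 : K), continuous (@GRing.inv K)}.
  by apply: inv_continuous; rewrite oner_neq0.
have expc j (f : K -> K) : {for 1, continuous f} -> {for 1, continuous (fun x => f x ^+ j)}.
  move=> fc; elim: j => [|j IHj].
    rewrite (_ : (fun x => _) = cst 1); first exact: cst_continuous.
    by apply/funext => x; rewrite expr0.
  rewrite (_ : (fun x => _) = (fun x => f x * f x ^+ j)); first exact: continuousM.
  by apply/funext => x; rewrite exprS.
have normb (f : K -> K) : f 1 = 1 -> {for 1, continuous f} ->
    {for 1, continuous (fun x => `|b.[f x]|)}.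
  move=> f1 fc; apply: (@continuous_comp _ _ _ (fun x => b.[f x]) Num.norm).
    by apply: (@continuous_comp _ _ _ f (horner b)) => //; exact: continuous_horner_num.
  exact: norm_continuous.
suff : {for 1, continuous h} by rewrite /prop_for /continuous_at h1; apply.
apply: continuousM; last first.
  by apply: continuousV; [rewrite normr_eq0|apply: (normb id)].
apply: continuousM; last by apply: normb => //; rewrite invr1.
by apply: continuousM; [apply: (expc _ id)|apply: expc].
Qed.

Lemma norm_horner_limit (b : {poly K}) (a : K) :
  (`|b.[x]| @[x --> a] --> `|b.[a]|)%classic.
Proof.
apply: (@continuous_comp _ _ _ (horner b) Num.norm).
  exact: continuous_horner_num.
exact: norm_continuous.
Qed.

End PolyContinuity.

Section CanonicalInner.
Variables (R : realType) (n : nat).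
Local Notation C := R[i].
Implicit Types (A B : mpoly n C) (m : multinom n) (z : 'rV[C]_n) (w : 'I_n -> C).

Definition reflection_quotient (c : C) m A z : C :=
  c * (meval (z 0) (mpolyX C m * reflection A) / meval (z 0) A).

Lemma cvg_real_complex (x : R) : (r%:C @[r --> x] --> (x%:C : C))%classic.
Proof.
apply/cvgrPdist_lt => e e0; have eE : e = (complex.Re e)%:C.
  by rewrite RRe_real // gtr0_real.
have Re0 : 0 < complex.Re e by rewrite -ltcR -eE.
have /cvgrPdist_lt/(_ _ Re0) : (r @[r --> x] --> x)%classic by exact: cvg_id.
apply: filterS => r; rewrite eE -ltcR; congr (_ < _).
by rewrite normc_def /= subrr expr0n addr0 sqrtr_sqr.
Qed.

Lemma meval_scale_row B w (r : R) :
  meval ((r%:C *: \row_j w j) 0) B = (radial w B).[r%:C].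
Proof. by rewrite horner_radial; apply: meval_eq => j; rewrite !mxE mulrC. Qed.

Lemma norm_meval_radial_limit B w :
  (`|meval ((r%:C *: \row_j w j) 0) B| @[r --> (1 : R)^'-] --> `|meval w B|)%classic.
Proof.
rewrite (_ : (fun r => _) = (fun r : R => `|(radial w B).[r%:C]|)); last first.
  by apply/funext => r; rewrite meval_scale_row.
have -> : meval w B = (radial w B).[1].
  by rewrite horner_radial; apply: meval_eq => j; rewrite mulr1.
have rC : (r%:C @[r --> (1 : R)^'-] --> (1 : C))%classic.
  by apply: cvg_at_left_filter; exact: cvg_real_complex.
have hcvg := @norm_horner_limit C (radial w B) 1.
by have := cvg_comp _ _ rC hcvg; exact.
Qed.

Lemma norm_reflection_radial A w (r : R) : (forall j, `|w j| = 1) -> 0 < r ->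
  `|meval (fun j => w j * r%:C) (reflection A)| =
  r%:C ^+ (\sum_j nu A j) * `|(radial w A).[r%:C^-1]|.
Proof.
move=> w1 r0; have r0' : r%:C != 0 :> C by rewrite fmorph_eq0 gt_eqF.
rewrite meval_radial_reflection // !normrM normcJ conjc_real normr_prod.
rewrite big1 ?mul1r => [|j _]; last by rewrite normrX w1 expr1n.
by rewrite normrX ger0_norm // ler0c ltW.
Qed.

(** Restricted to the line through w, the moduli of A^ and A at r are those of
r^N a(1/r) and a(r).  Writing a = (X - 1)^k b with b(1) != 0, the factors
|1/r - 1|^k and |r - 1|^k cancel up to a power of r, so the limit exists at every
point of the torus. *)
Lemma radial_limit A m w c : `|c| = 1 -> zero_free A -> (forall j, `|w j| = 1) ->
  (`|reflection_quotient c m A (r%:C *: \row_j w j)| @[r --> (1 : R)^'-] --> (1 : C))%classic.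
Proof.
move=> c1 Anz w1; pose a := radial w A.
(* the zero of A at w itself, if any, has order k along the radius *)
have [k [b]] := multiplicity_XsubC a 1.
have aN0 : a != 0.
  apply: contra_neq (zero_free0 Anz) => a0.
  rewrite -(@meval_eq _ _ (fun j => w j * 0)) => [|j]; last by rewrite mulr0.
  by rewrite -horner_radial -/a a0 horner0.
rewrite aN0 /= => b1 aE; pose i := (\sum_j m j + \sum_j nu A j)%N.
have hcvg := @quotient_limit C b i k b1.
have : (r%:C ^+ i * r%:C^-1 ^+ k * `|b.[r%:C^-1]| / `|b.[r%:C]| @[r --> (1 : R)^'-]
    --> (1 : C))%classic.
  have rC : (r%:C @[r --> (1 : R)^'-] --> (1 : C))%classic.
    by apply: cvg_at_left_filter; exact: cvg_real_complex.
  by have := cvg_comp _ _ rC hcvg; exact.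
apply: cvg_trans; apply: near_eq_cvg; near=> r.
have r0 : 0 < r by near: r; apply: nbhs_left_gt.
have r1 : r < 1 by near: r; apply: nbhs_left_lt.
have rC : r%:C != 0 :> C by rewrite fmorph_eq0 gt_eqF.
have rC1 : r%:C - 1 != 0 :> C 
  by rewrite -[1](rmorph1 (@real_complex R)) -rmorphB fmorph_eq0 subr_eq0 lt_eqF.
have rN : `|r%:C| = r%:C :> C by rewrite ger0_norm // ler0c ltW.
have rowE B : meval ((r%:C *: \row_j w j) 0) B = meval (fun j => w j * r%:C) B.
  by rewrite meval_scale_row horner_radial.
rewrite /reflection_quotient normrM c1 mul1r normrM normfV !rowE mevalM normrM.
rewrite norm_reflection_radial // -horner_radial -/a.
have -> : `|meval (fun j => w j * r%:C) (mpolyX C m)| = r%:C ^+ (\sum_j m j).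
  rewrite mevalX normr_prod -prodrXr; apply: eq_bigr => j _.
  by rewrite normrX normrM w1 mul1r rN.
rewrite aE !hornerM !horner_exp !hornerXsubC !normrM !normrX.
have -> : `|r%:C^-1 - 1| = r%:C^-1 * `|r%:C - 1| :> C.
  rewrite -{2}rN -normfV -normrM mulrBr mulVf // mulr1 distrC.
  by [].
have dN0 : `|r%:C - 1| ^+ k != 0 :> C by rewrite expf_neq0 // normr_eq0.
have cancel_zero (x y z p q d : C) : d != 0 ->
    x * y * z * p / q = x * (y * (p * (z * d))) / (q * d).
  move=> d0; rewrite invfM; apply/esym; rewrite -[RHS]mulr1 -(divff d0); ring.
by rewrite exprMn /i exprD; exact: cancel_zero.
Unshelve. all: by end_near.
Qed.

Lemma rational_inner_quotient c m A : (0 < n)%N -> `|c| = 1 -> zero_free A ->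
  rational_inner (reflection_quotient c m A).
Proof.
move=> n0 c1 Anz; have zf z : polydisc z -> meval (z 0) A != 0 by move=> z1; apply: Anz.
split; last first.
  exists (c *: (mpolyX C m * reflection A)), A; split; first exact: zero_free_neq0.
  by move=> z z1 _; rewrite /reflection_quotient mevalZ mulrA.
split.
- move=> z z1; apply: differentiableM; first exact: differentiable_cst.
  apply: differentiableM; first exact: differentiable_meval.
  by apply: differentiableV; [exact: differentiable_meval|exact: zf].
- exists 1 => z z1; rewrite /reflection_quotient normrM c1 mul1r normrM normfV.
  rewrite ler_pdivrMr ?normr_gt0 ?zf // mul1r mevalM normrM.
  rewrite -[leRHS]mul1r ler_pM //; last exact: norm_reflection_le.
  rewrite mevalX normr_prod; apply: prodr_ile1 => j _.
  by rewrite normrX exprn_ge0 // exprn_ile1 // ltW // z1.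
- rewrite /ae_torus; set S := [set _ | _]%classic.
  suff -> : S = set0 by apply: lebesgue_null0.
  apply/seteqP; split => // t [_ []].
  have -> : torus_point t = \row_j (torus_point t 0 j).
    by apply/rowP => j; rewrite !mxE.
  apply: radial_limit => // j; exact: norm_torus_point.
Qed.

End CanonicalInner.

(** * The canonical form of a rational inner function *)

Lemma coprime_divides (R : idomainType) (P : R) (s : seq R) :
  (forall p, p \in s -> prime_elt p /\ ~ divides p P) ->
  forall Y, divides (\prod_(p <- s) p) (P * Y) -> divides (\prod_(p <- s) p) Y.
Proof.
elim: s => [|p s IHs] sP Y; first by rewrite big_nil; exists Y; rewrite mulr1.
rewrite big_cons => -[d E]; have [[p0 _ pP] pNP] := sP p (mem_head _ _).
have [//|[Y' YE]] : divides p P \/ divides p Y.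
  by apply: pP; exists (d * \prod_(j <- s) j); rewrite E; ring.
have [|e Y'E] := IHs (fun q qs => sP q (mem_behead (s := p :: s) qs)) Y'.
  by exists d; apply: (mulfI p0); move: E; rewrite YE => E; rewrite mulrCA -[RHS]mulrCA -E; ring.
by exists e; rewrite YE Y'E; ring.
Qed.

Lemma reduced_divides (R : idomainType) (P Q : R) : factorial_ring R -> Q != 0 ->
  (forall h P1 Q1, prime_elt h -> P = P1 * h -> Q = Q1 * h -> False) ->
  forall Y, divides Q (P * Y) -> divides Q Y.
Proof.
move=> ufd Q0 red Y [e E]; have [u [s [uU sP QE]]] := ufd Q Q0.
have sNP p : p \in s -> prime_elt p /\ ~ divides p P.
  move=> ps; split; first exact: sP.
  move=> [P1 PE]; apply: (red p P1 (u * \prod_(q <- rem p s) q) (sP p ps) PE).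
  by rewrite QE (big_rem p ps) /= mulrCA mulrC.
have dvd : divides (\prod_(p <- s) p) (P * Y).
  by exists (e * u); rewrite E QE mulrA.
have [d dE] := coprime_divides sNP dvd.
by exists (d * u^-1); rewrite dE QE mulrA divrK.
Qed.

Lemma cofactor_eq (R : idomainType) (P Q A B S : R) :
  Q != 0 -> P * A = Q * B -> A = S * Q -> B = P * S.
Proof. by move=> Q0 E AE; apply: (mulfI Q0); rewrite -E AE mulrA mulrC. Qed.

Lemma cancel_cofactor (R : idomainType) (P S A X : R) :
  P != 0 -> A * (P * S) = X * P -> A * S = X.
Proof. by move=> P0 E; apply: (mulIf P0); rewrite -E mulrAC mulrA. Qed.

Lemma ex_minimal (T : Type) (P : T -> Prop) (f : T -> nat) : (exists x, P x) ->
  exists2 x, P x & forall y, P y -> (f x <= f y)%N.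
Proof.
move=> [x Px]; have [k] := ubnP (f x); elim: k x Px => // k IHk x Px fx.
have [|nmin] := pselect (forall y, P y -> (f x <= f y)%N); first by exists x.
have /existsNP [y /not_implyP [Py /negP]] := nmin; rewrite -ltnNge => yx.
by apply: (IHk y Py); move: fx yx; lia.
Qed.

Section CanonicalForm.
Variables (R : realType) (n : nat).
Local Notation C := R[i].
Implicit Types (A B P Q : mpoly n C) (f : 'rV[C]_n -> C).

Lemma msize_factor A B : A != 0 -> B != 0 -> A \isn't a GRing.unit ->
  (msize B < msize (A * B)%R)%N.
Proof.
move=> A0 B0 AU; rewrite msizeM //; have Agt1 : (1 < msize A)%N.
  by rewrite ltnNge; apply: contra AU; apply: msize_unit.
have Bgt0 : (0 < msize B)%N by rewrite lt0n msize_poly_eq0.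
case: (msize A) Agt1 => [|[|a]] // _; case: (msize B) Bgt0 => // b _.
by rewrite addSn /= addSn ltnS leq_addl.
Qed.

(** The nonzero set of h is dense, and F is continuous. *)
Lemma vanish_on_polydisc (h : mpoly n C) (F : 'rV[C]_n -> C) : h != 0 ->
  (forall z, polydisc z -> differentiable F z) ->
  (forall z, polydisc z -> meval (z 0) h != 0 -> F z = 0) ->
  forall z, polydisc z -> F z = 0.
Proof.
move=> h0 Fdiff Fh z z1; apply: contrapT => /eqP Fz.
have lt0 : 0 < `|F z| by rewrite normr_gt0.
have Fcont : {for z, continuous F} by apply: differentiable_continuous; exact: Fdiff.
have /cvgr_norm_gt/(_ _ lt0) near_F := Fcont.
have [d d0 dP] : exists2 d : C, 0 < d & forall v : 'I_n -> C,
    (forall j, `|v j - z 0 j| < d) -> 0 < `|F (\row_j v j)| /\ polydisc (\row_j v j).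
  apply: (@near_row _ _ (fun x => 0 < `|F x| /\ polydisc x)).
  by near=> x; split; near: x; [exact: near_F|exact: near_polydisc].
have [v vz vh] := mpoly_nonzero_in (fun j => infinite_ball (z 0 j) d0) h0.
have [Fv v1] := dP v vz; have rowE : meval ((\row_j v j) 0) h = meval v h.
  by apply: meval_eq => j; rewrite mxE.
have F0 : F (\row_j v j) = 0 by apply: (Fh _ v1); rewrite rowE.
by move: Fv; rewrite F0 normr0 ltxx.
Unshelve. all: by end_near.
Qed.

Definition fraction_of f P Q : Prop :=
  Q != 0 /\ forall z, polydisc z -> f z * meval (z 0) Q = meval (z 0) P.

Lemma fraction_of_cancel f (h P Q : mpoly n C) : holomorphic f ->
  h * Q != 0 ->
  (forall z, polydisc z -> meval (z 0) h != 0 ->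
     f z * meval (z 0) Q = meval (z 0) P) ->
  fraction_of f P Q.
Proof.
move=> fhol hQ0 E; have [h0 Q0] : h != 0 /\ Q != 0.
  by move: hQ0; rewrite mulf_eq0 negb_or => /andP.
split => // z z1; apply/eqP; rewrite -subr_eq0; apply/eqP; move: z z1.
apply: (vanish_on_polydisc h0) => [z z1|z z1 hz]; last by rewrite E ?subrr.
apply: differentiableB; last exact: differentiable_meval.
by apply: differentiableM; [exact: fhol|exact: differentiable_meval].
Qed.

Lemma rational_fraction f : holomorphic f -> Defs.rational f ->
  exists P Q, fraction_of f P Q.
Proof.
move=> fhol [P [Q [Q0 E]]]; exists P, Q.
apply: (fraction_of_cancel (h := Q)); rewrite ?mulf_neq0 // => z z1 Qz.
by rewrite E // divfK.
Qed.

Definition reduced_fraction f P Q : Prop :=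
  forall h P1 Q1, prime_elt h -> P = P1 * h -> Q = Q1 * h -> False.

(** Take a denominator of least degree: a common prime factor could be
cancelled. *)
Lemma reduced_fraction_exists f : holomorphic f -> Defs.rational f ->
  exists P Q, fraction_of f P Q /\ reduced_fraction f P Q.
Proof.
move=> fhol frat.
have [|[P Q] /= fPQ minQ] := @ex_minimal _ (fun PQ => fraction_of f PQ.1 PQ.2)
    (fun PQ => msize PQ.2).
  by have [P [Q fPQ]] := rational_fraction fhol frat; exists (P, Q).
exists P, Q; split=> // h P1 Q1 hp PE QE; have [h0 hU _] := hp.
have [Q0 fE] := fPQ; have Q10 : Q1 != 0.
  by apply: contra_neq Q0 => Q10; rewrite QE Q10 mul0r.
have fPQ1 : fraction_of f P1 Q1.
  apply: (fraction_of_cancel (h := h)); rewrite ?mulf_neq0 // => z z1 hz.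
  by apply: (mulIf hz); rewrite -mulrA -!mevalM -QE -PE fE.
have /= := minQ (P1, Q1) fPQ1; rewrite leqNgt QE [Q1 * h]mulrC => /negP; apply.
exact: msize_factor.
Qed.

(** At a zero of Q some prime factor q of Q vanishes.  Now P = f Q vanishes with
q in the polydisc, so q divides P as well. *)
Lemma reduced_zero_free f P Q : fraction_of f P Q -> reduced_fraction f P Q ->
  zero_free Q.
Proof.
move=> [Q0 fE] red v v1; apply/eqP => vQ.
have [u [s [uU sP QE]]] := factorial_mpoly Q0.
have [a a0 uE] := mpoly_unit_const uU.
have [q qs qv] : exists2 q, q \in s & meval v q = 0.
  move: vQ; rewrite QE mevalM uE mevalC rmorph_prod => /eqP.
  rewrite mulf_eq0 (negPf a0) prodf_seq_eq0 => /hasP [q qs /= /eqP qv].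
  by exists q.
have qp := sP q qs; pose Q1 := u * \prod_(p <- rem q s) p.
have QE1 : Q = Q1 * q by rewrite QE (big_rem q) //= /Q1; ring.
have [|P1 PE] := prime_zero_divides qp v1 qv (p := P); last exact: (red _ _ _ qp PE QE1).
move=> w w1 wq; have rowE B : meval ((\row_j w j) 0) B = meval w B.
  by apply: meval_eq => j; rewrite mxE.
have wD : polydisc (\row_j w j) by move=> j; rewrite mxE.
by rewrite -rowE -fE // QE1 mevalM !rowE wq !mulr0.
Qed.

(** Pass to the limit in |f(rw)| |Q(rw)| = |P(rw)|. *)
Lemma inner_torus_norm f P Q (t : 'rV[R]_n) : fraction_of f P Q ->
  (`|f (r%:C *: torus_point t)| @[r --> (1 : R)^'-] --> (1 : C))%classic ->
  `|meval (torus_point t 0) P| = `|meval (torus_point t 0) Q|.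
Proof.
move=> [_ fE] flim; pose w := torus_point t 0.
have tE : torus_point t = \row_j w j by apply/rowP => j; rewrite mxE.
have limM : (`|f (r%:C *: torus_point t)| *
    `|meval ((r%:C *: torus_point t) 0) Q| @[r --> (1 : R)^'-] -->
    1 * `|meval w Q|)%classic.
  apply: cvgM; first exact: flim.
  by rewrite tE; exact: norm_meval_radial_limit.
have limP : (`|meval ((r%:C *: torus_point t) 0) P| @[r --> (1 : R)^'-] -->
    1 * `|meval w Q|)%classic.
  apply: cvg_trans limM; apply: near_eq_cvg; near=> r.
  have r0 : 0 < r by near: r; apply: nbhs_left_gt.
  have r1 : r < 1 by near: r; apply: nbhs_left_lt.
  rewrite -fE ?normrM // => j; rewrite mxE normrM norm_torus_point mulr1.
  by rewrite ger0_norm ?ler0c ?ltW // -[ltRHS](rmorph1 (@real_complex R)) ltcR.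
rewrite mul1r tE in limP.
exact: (cvg_unique (@norm_hausdorff _ _) (@norm_meval_radial_limit _ _ P w) limP).
Unshelve. all: by end_near.
Qed.

(** At a point w of the torus both sides are w^N times |P|^2 and |Q|^2, which
agree at almost every w. *)
Lemma torus_identity f P Q N : inner f -> fraction_of f P Q ->
  degree_le N P -> degree_le N Q -> P * reflect_at N P = Q * reflect_at N Q.
Proof.
move=> [_ _ flim] fPQ PN QN.
pose T : mpoly n C := P * reflect_at N P - Q * reflect_at N Q.
have cancel (x y a b W : C) : a = W * conjc x -> b = W * conjc y ->
    `|x| = `|y| -> x * a - y * b = 0.
  have sq u : u * (W * conjc u) = W * `|u| ^+ 2 by rewrite sqr_normc mulrCA.
  by move=> -> -> xy; rewrite !sq xy subrr.
have mevalMB (w : 'I_n -> C) A B D E :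
    meval w (A * B - D * E) = meval w A * meval w B - meval w D * meval w E.
  by rewrite mevalB !mevalM.
have TE (w : 'I_n -> C) : (forall j, `|w j| = 1) ->
    `|meval w P| = `|meval w Q| -> meval w T = 0.
  move=> w1 PQ; apply: etrans (mevalMB _ _ _ _ _) _.
  exact: (cancel _ _ _ _ _ (meval_reflect_torus PN w1) (meval_reflect_torus QN w1) PQ).
apply/eqP; rewrite -subr_eq0; apply: contrapT => /negP T0.
have [t [tI tA tT]] := null_avoid flim T0.
have {tA} tlim : (`|f (r%:C *: torus_point t)| @[r --> (1 : R)^'-] --> (1 : C))%classic.
  by apply: contrapT => Nlim; apply: tA; split.
move/eqP: tT; apply.
exact: (TE _ (norm_torus_point t) (inner_torus_norm fPQ tlim)).
Qed.

Lemma reflect_monomial (c : C) (k : multinom n) : c != 0 ->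
  reflect_at k (c *: mpolyX C k) = mpolyC n (conjc c).
Proof.
move=> c0; rewrite /reflect_at msuppMCX // big_seq1 mcoeff_map_mpoly.
rewrite mcoeffZ mcoeffX eqxx mulr1 (_ : mnm_sub k k = mnm0) ?mpolyX0.
  by rewrite -mul_mpolyC mulr1.
by apply/mnmP => j; rewrite mnmBE subnn mnm0E.
Qed.

Lemma degree_le_monomial (c : C) (k : multinom n) : degree_le k (c *: mpolyX C k).
Proof. by move=> m /msuppZ_le; rewrite msuppX inE => /eqP ->. Qed.

Lemma mcoeff_monomialM (a : C) (k m : multinom n) B :
  mcoeff (mnm_add k m) ((a *: mpolyX C k) * B) = a * mcoeff m B.
Proof. by rewrite -scalerAl mcoeffZ [_ * B]mulrC mcoeffMX. Qed.

Lemma norm_eq_of_product (A B D E : mpoly n C) (w : 'I_n -> C) : A * B = D * E ->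
  `|meval w B| = `|meval w A| -> `|meval w E| = `|meval w D| ->
  `|meval w A| = `|meval w D|.
Proof.
move=> /(congr1 (fun F : mpoly n C => `|meval w F|)); rewrite !mevalM !normrM => E0 AB DE.
by apply/eqP; rewrite -(eqrXn2 (n := 2)) // !expr2 -{2}AB -{2}DE E0.
Qed.

Lemma norm_monomialM_torus (w : 'I_n -> C) (m : multinom n) B :
  (forall j, `|w j| = 1) -> `|meval w (mpolyX C m * B)| = `|meval w B|.
Proof.
move=> w1; rewrite mevalM normrM mevalX normr_prod big1 ?mul1r // => j _.
by rewrite normrX w1 expr1n.
Qed.

Lemma norm_factor_torus (a p x q : C) :
  p = conjc a * x -> `|x| = `|q| -> `|p| = `|q| -> q != 0 -> `|conjc a| = 1.
Proof.
move=> -> xq; rewrite normrM xq => E q0; move: E; rewrite -[RHS]mul1r.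
by apply: mulIf; rewrite normr_eq0.
Qed.

Lemma mnm_split (N k u : multinom n) : (forall j, (k j + u j <= N j)%N) ->
  N = mnm_add k (mnm_add (mnm_sub N (mnm_add k u)) u).
Proof.
move=> kN; apply/mnmP => j; rewrite !mnmDE mnmBE mnmDE.
by rewrite [(_ - _ + _)%N]addnC addnA subnKC // kN.
Qed.

(** From P P* = Q Q* with P, Q coprime, P* = S Q and Q* = P S.  Reflecting
P* = S Q gives z^nu(S) P = S^ Q* = S^ S P, hence S^ S is a monomial; so is its
divisor S, and reflecting P* = a z^k Q expresses P through the reflection of Q. *)
Theorem rational_inner_form f : (0 < n)%N -> rational_inner f -> exists c m Q,
  [/\ `|c| = 1, zero_free Q &
      forall z, polydisc z -> f z = reflection_quotient c m Q z].
Proof.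
move=> n0 [finn frat]; have [fhol _ _] := finn.
have [P [Q [fPQ red]]] := reduced_fraction_exists fhol frat.
have Qzf := reduced_zero_free fPQ red; have [Q0 fE] := fPQ.
pose N := mnm_add (nu P) (nu Q).
have PN : degree_le N P.
  by move=> m mP j; rewrite mnmDE (leq_trans (le_nu j mP)) ?leq_addr.
have QN : degree_le N Q.
  by move=> m mQ j; rewrite mnmDE (leq_trans (le_nu j mQ)) ?leq_addl.
have PQ := torus_identity finn fPQ PN QN.
have R0 B : degree_le N B -> B != 0 -> reflect_at N B != 0.
  move=> BN; apply: contra_neq => B0; rewrite -(reflectK BN) B0.
  by rewrite /reflect_at msupp0 big_nil.
have P0 : P != 0.
  apply: contraTneq (mulf_neq0 Q0 (R0 Q QN Q0)) => P0.
  by rewrite -PQ P0 mul0r eqxx.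
have [S SE] : @divides (mpoly n C) Q (reflect_at N P).
  apply: (reduced_divides (@factorial_mpoly _ n) Q0 red); rewrite PQ.
  exact/divides_mulr/divides_refl.
have QE : reflect_at N Q = P * S := cofactor_eq Q0 PQ SE.
have S0 : S != 0.
  by apply: contra_neq (R0 P PN P0) => S0; rewrite SE S0 mul0r.
have Smon : reflection S * S = mpolyX C (nu S).
  have E1 := reflectM (@degree_le_nu _ _ S) QN.
  have E2 := etrans (reflect_add (nu S) (@degree_le_reflect _ _ N P))
    (congr1 ( *%R (mpolyX C (nu S))) (reflectK PN)).
  apply: (cancel_cofactor P0); apply: etrans E2.
  apply: etrans (congr1 ( *%R (reflection S)) (esym QE)) _.
  apply: etrans (esym E1) _.
  by congr (reflect_at _ _); rewrite SE.
have [a [k SkE]] : exists (a : C) (k : multinom n), S = a *: mpolyX C k.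
  by apply: (@divisor_monomial _ _ S (reflection S) (nu S)); rewrite mulrC.
have a0 : a != 0 by apply: contra_neq S0 => a0; rewrite SkE a0 scale0r.
have kN : forall j, (k j + nu Q j <= N j)%N.
  move=> j; have [m mQ <-] := nu_attained j Q0.
  have : mnm_add k m \in msupp (reflect_at N P).
    have coefE : mcoeff (mnm_add k m) (reflect_at N P) = a * mcoeff m Q.
      by rewrite SE SkE; exact: mcoeff_monomialM.
    have mQ0 : mcoeff m Q != 0 by rewrite -mcoeff_msupp.
    have /eqP am0 : a * mcoeff m Q != 0 := mulf_neq0 a0 mQ0.
    rewrite mcoeff_msupp; apply/eqP => c0.
    by apply: am0; exact: etrans (esym coefE) c0.
  by move/degree_le_reflect/(_ j); rewrite mnmDE.
pose L := mnm_sub N (mnm_add k (nu Q)).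
have NE : N = mnm_add k (mnm_add L (nu Q)) by apply: mnm_split.
have PE : P = conjc a *: (mpolyX C L * reflection Q).
  have R1 : reflect_at N P = (a *: mpolyX C k) * Q by rewrite SE SkE.
  have LQ : degree_le (mnm_add L (nu Q)) Q.
    by move=> m mQ j; rewrite mnmDE (leq_trans (le_nu j mQ)) ?leq_addl.
  apply: etrans (esym (reflectK PN)) _.
  apply: etrans (congr1 (reflect_at N) R1) _.
  apply: etrans (congr1 (fun M => reflect_at M ((a *: mpolyX C k) * Q)) NE) _.
  apply: etrans (reflectM (@degree_le_monomial a k) LQ) _.
  apply: etrans (congr2 *%R (reflect_monomial k a0) (reflect_add L (@degree_le_nu _ _ Q))) _.
  exact: mul_mpolyC.
have PEv (v : 'I_n -> C) :
    meval v P = conjc a * meval v (mpolyX C L * reflection Q).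
  by rewrite PE mevalZ.
exists (conjc a), L, Q; split; [|exact: Qzf|]; last first.
  move=> z z1; have Qz : meval (z 0) Q != 0 by apply: Qzf.
  apply: (mulIf Qz); rewrite (fE z z1) PEv /reflection_quotient.
  by rewrite -[RHS]mulrA divfK.
have [w w1 wQ] := torus_nonzero n0 Q0.
have wP : `|meval w P| = `|meval w Q|.
  exact: (norm_eq_of_product PQ (norm_reflect_torus PN w1) (norm_reflect_torus QN w1)).
have wR : `|meval w (reflection Q)| = `|meval w Q|.
  by apply: norm_reflect_torus w1; exact: degree_le_nu.
have wX : `|meval w (mpolyX C L * reflection Q)| = `|meval w Q|.
  exact: etrans (norm_monomialM_torus _ _ w1) wR.
exact: (norm_factor_torus (PEv w) wX wP wQ).
Qed.

End CanonicalForm.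

(** * Irreducible rational inner functions *)

Section Irreducibility.
Variables (R : realType) (n : nat).
Local Notation C := R[i].
Implicit Types (A B Q : mpoly n C) (m : multinom n).

Lemma zero_free_factors A B : zero_free (A * B) -> zero_free A /\ zero_free B.
Proof.
by move=> AB; split=> v /AB; rewrite mevalM mulf_eq0 negb_or => /andP[].
Qed.

Lemma meval_origin Q : meval (fun=> 0) Q = mcoeff mnm0 Q.
Proof.
apply: (mpoly_morph_ext (f := meval (fun=> 0)) (g := mcoeff mnm0)) => [c|j] /=.
  by rewrite mevalC mcoeffC eqxx mulr1.
rewrite mevalXU mcoeffX (_ : _ == _ = false) //; apply/eqP => /mnmP/(_ j).
by rewrite mnm0E mnm1E eqxx.
Qed.

(** A unit has no zero in the polydisc, and a monomial without zero at the
origin is constant. *)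
Lemma quotient_unit c m A : (0 < n)%N -> `|c| = 1 -> zero_free A ->
  holomorphic_unit (reflection_quotient c m A) ->
  m = mnm0 /\ exists2 k : C, `|k| = 1 &
    forall z : 'rV[C]_n, meval (z 0) (reflection A) = k * meval (z 0) A.
Proof.
move=> n0 c1 Anz [_ [g _ gE]].
have zf : zero_free (mpolyX C m * reflection A).
  move=> v v1; have vD : polydisc (\row_j v j) by move=> j; rewrite mxE.
  have rowE B : meval ((\row_j v j) 0) B = meval v B.
    by apply: meval_eq => j; rewrite mxE.
  have := gE _ vD; rewrite /reflection_quotient !rowE.
  by apply: contra_eq_neq => ->; rewrite mul0r mulr0 mul0r eq_sym oner_neq0.
have [Xzf Rzf] := zero_free_factors zf; split.
  apply/eqP; apply: contraT => /multinom_neq0 [j [m' mE]].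
  have := zero_free0 Xzf; rewrite mE mpolyXD mevalM mevalXU mul0r.
  by rewrite eqxx.
have [k k1 kE] := reflection_unit n0 Anz Rzf; exists k => // z.
by rewrite kE mevalZ.
Qed.

Lemma nu_monomial (c : C) m : c != 0 -> nu (c *: mpolyX C m) = m.
Proof.
by move=> c0; apply/mnmP => j; rewrite /nu mnmE msuppMCX // big_seq1.
Qed.

Lemma reflection1 : reflection (1 : mpoly n C) = 1.
Proof.
have -> : 1 = (1 : C) *: mpolyX C (mnm0 : multinom n) by rewrite scale1r mpolyX0.
rewrite -[LHS]/(reflect_at (nu _) _) nu_monomial ?oner_neq0 //.
by rewrite reflect_monomial ?oner_neq0 // rmorph1 mpolyC1 scale1r mpolyX0.
Qed.

Lemma deficient_nonunit Q : deficient Q -> Q \isn't a GRing.unit.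
Proof.
move=> Qdef; apply/negP => /mpoly_unit_const [a a0 QE]; move/negP: Qdef; apply.
have -> : Q = a *: mpolyX C (mnm0 : multinom n).
  by rewrite QE mpolyX0 -mul_mpolyC mulr1.
by rewrite nu_monomial // msuppMCX // mem_head.
Qed.

End Irreducibility.

Theorem corollary2p3 (R : realType) (n : nat) (f : 'rV[R[i]]_n -> R[i])
    (hf : irreducible_rational_inner f) (f0 : f 0 = 0) :
  exists c : R[i], `|c| = 1 /\
    ((exists j : 'I_n, forall z, polydisc z -> f z = c * z 0 j) \/
     (exists Q : mpoly n R[i],
        [/\ irreducible_mpoly Q,
            forall z : 'rV[R[i]]_n, polydisc z -> meval (z 0) Q != 0,
            deficient Q &
            forall z, polydisc z ->
              f z = c * (meval (z 0) (reflection Q) / meval (z 0) Q)])).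
Proof.
have [fin fnc firr] := hf.
have origin1 : polydisc (0 : 'rV[R[i]]_n) by move=> j; rewrite mxE normr0.
(* on the one-point polydisc of C^0 every function is constant *)
have n0 : (0 < n)%N.
  rewrite lt0n; apply/eqP => nE; apply: fnc; exists (f 0) => z _; congr f.
  by apply/rowP => j; have := ltn_ord j; rewrite [X in (_ < X)%N]nE.
have [|[[c m] Q] /= [c1 Qzf fE] Qmin] := @ex_minimal (R[i] * multinom n * mpoly n R[i])
  (fun t => [/\ `|t.1.1| = 1, zero_free t.2 &
     forall z, polydisc z -> f z = reflection_quotient t.1.1 t.1.2 t.2 z])
  (fun t => msize t.2).
  by have [c [m [Q h]]] := rational_inner_form n0 fin; exists (c, m, Q).
have Q0 := zero_free_neq0 Qzf.
have Qz z : polydisc z -> meval (z 0) Q != 0 by move=> z1; apply: Qzf.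
have [m0|/multinom_neq0 [j [m' mE]]] := eqVneq m mnm0; last first.
  have oneE : reflection_quotient 1 (mnm1 j) 1 =1 (fun z : 'rV[R[i]]_n => z 0 j).
    move=> z; rewrite /reflection_quotient reflection1 mulr1 mevalXU meval1.
    by rewrite divr1 mul1r.
  have zf1 : zero_free (1 : mpoly n R[i]) by move=> v _; rewrite meval1 oner_neq0.
  have split_f z : polydisc z -> f z =
      reflection_quotient 1 (mnm1 j) 1 z * reflection_quotient c m' Q z.
    move=> z1; rewrite fE // oneE /reflection_quotient mE mpolyXD !mevalM mevalXU.
    by ring.
  have hunit : holomorphic_unit (reflection_quotient c m' Q).
    apply: contrapT => Nunit; apply: firr.
    exists (reflection_quotient 1 (mnm1 j) 1), (reflection_quotient c m' Q); split=> //.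
    - by apply: (rational_inner_quotient _ n0 _ zf1); exact: normr1.
    - exact: rational_inner_quotient.
    - move=> /quotient_unit [||//|/mnmP/(_ j)]; rewrite ?normr1 //.
      by rewrite mnm1E mnm0E eqxx.
  have [m'0 [k k1 kE]] := quotient_unit n0 c1 Qzf hunit.
  exists (c * k); split; first by rewrite normrM c1 k1 mulr1.
  left; exists j => z z1; rewrite split_f // oneE /reflection_quotient m'0 mpolyX0 mul1r.
  by rewrite kE mulfK ?Qz // mulrC.
have {}fE z : polydisc z ->
    f z = c * (meval (z 0) (reflection Q) / meval (z 0) Q).
  by move=> z1; rewrite fE // /reflection_quotient m0 mpolyX0 mul1r.
have Qdef : deficient Q.
  have : meval (fun=> 0) (reflection Q) = 0.
    have := fE _ origin1; rewrite f0 => /esym/eqP.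
    rewrite mulf_eq0 -normr_eq0 c1 oner_eq0 /= mulf_eq0 invr_eq0.
    rewrite (negPf (Qz _ origin1)) orbF => /eqP R0.
    by rewrite -[RHS]R0; apply: meval_eq => j; rewrite mxE.
  rewrite meval_origin -[reflection Q]/(reflect_at _ _) mcoeff_reflect.
  - rewrite (_ : mnm_sub (nu Q) mnm0 = nu Q); last exact: subm0.
    by move=> /eqP; rewrite conjc_eq0 mcoeff_eq0.
  - exact: degree_le_nu.
  - by move=> j; rewrite mnm0E.
exists c; split=> //; right; exists Q; split=> //.
split=> //; first exact: deficient_nonunit.
move=> A B QE; have [A0 B0] : A != 0 /\ B != 0.
  by move: Q0; rewrite QE mulf_eq0 negb_or => /andP[].
have [Azf Bzf] : zero_free A /\ zero_free B by apply: zero_free_factors; rewrite -QE.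
have split_f z : polydisc z -> f z =
    reflection_quotient c mnm0 A z * reflection_quotient 1 mnm0 B z.
  move=> z1; rewrite fE // /reflection_quotient mpolyX0 !mul1r QE reflectionM //.
  by rewrite !mevalM invfM; ring.
have [AU|AU] := boolP (A \is a GRing.unit); first by left.
have [BU|BU] := boolP (B \is a GRing.unit); first by right.
have Bz z : polydisc z -> meval (z 0) B != 0 by move=> z1; apply: Bzf.
have cancel_unit (a x y : R[i]) : y != 0 -> c * (a * y / y) * x = c * a * x.
  by move=> y0; rewrite mulfK // mulrA.
exfalso; have norm1 : `|1 : R[i]| = 1 by rewrite normr1.
have [gunit|Ngunit] := pselect (holomorphic_unit (reflection_quotient c mnm0 A)).
  have [_ [k k1 kE]] := quotient_unit n0 c1 Azf gunit.
  have /= := Qmin (c * k, mnm0, B); rewrite leqNgt QE msize_factor // => /(_ _)/negP.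
  case=> //; split => //=; first by rewrite normrM c1 k1 mulr1.
  move=> z z1; rewrite split_f // /reflection_quotient mpolyX0 !mul1r kE.
  exact: cancel_unit (Azf _ z1).
have [hunit|Nhunit] := pselect (holomorphic_unit (reflection_quotient 1 mnm0 B)).
  have [_ [k k1 kE]] := quotient_unit n0 norm1 Bzf hunit.
  have /= := Qmin (c * k, mnm0, A).
  rewrite leqNgt QE [A * B]mulrC msize_factor // => /(_ _)/negP.
  case=> //; split => //=; first by rewrite normrM c1 k1 mulr1.
  move=> z z1; rewrite split_f // /reflection_quotient mpolyX0 !mul1r kE.
  by rewrite mulfK ?Bz // mulrAC mulrA.
apply: firr; exists (reflection_quotient c mnm0 A), (reflection_quotient 1 mnm0 B).
by split=> //; apply: rational_inner_quotient.
Qed.
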